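(* Let $\mathbb K$ be a triangulation of an open disc, with vertex set $\mathbb K^0$ and $1$-skeleton $\mathbb K^1$. If $\mathbb K^1$ is of bounded degree and transient, then there exists a non-constant, Dirichlet-finite, harmonic function $f:\mathbb K^0\to\mathbb R$ for the simple random walk on $\mathbb K^1$.
   Context: A triangulation of an open disc is an infinite, locally finite simplicial $2$-complex $\mathbb K$ without boundary that triangulates an open topological disc in $\mathbb C$. $\mathbb K^0$ and $\mathbb K^1$ denote its vertex set and edge set; $\mathbb K^1$ is also regarded as a graph (the $1$-skeleton). Bounded degree means the vertex degrees in $\mathbb K^1$ are uniformly bounded. Write $u\sim v$ when $uv\in\mathbb K^1$. The simple random walk on $\mathbb K^1$ moves from a vertex to each of its neighbours with equal probability (all edge conductances equal $1$). A random walk is recurrent if the probability of visiting any vertex infinitely many times is $1$, and transient otherwise; the graph $\mathbb K^1$ is called transient if the simple random walk on it is transient. A function $f:\mathbb K^0\to\mathbb R$ is harmonic for the simple random walk if $f(v)=\frac1{\deg v}\sum_{u\sim v}f(u)$ for every $v\in\mathbb K^0$, and it is Dirichlet-finite if $\sum_{uv\in\mathbb K^1}(f(u)-f(v))^2<\infty$. *)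

(* Defs.v *)
From HB Require Import structures.
From mathcomp Require Import all_boot all_order all_algebra.
From mathcomp Require Import finmap.
From mathcomp Require Import all_classical all_reals all_analysis.

Set Implicit Arguments.
Unset Strict Implicit.
Unset Printing Implicit Defensive.

Import Order.TTheory GRing.Theory Num.Theory.
Import numFieldNormedType.Exports.

Local Open Scope classical_set_scope.
Local Open Scope ring_scope.

Definition homeomorphic_sets (S T : topologicalType) (A : set S) (B : set T) :
    Prop :=
  exists (f : S -> T) (g : T -> S),
    [/\ set_fun A B f, {within A, continuous f}
      & set_fun B A g /\ {within B, continuous g}]
    /\ (forall x, A x -> g (f x) = x) /\ (forall y, B y -> f (g y) = y).

(** The complex plane is used only through its topology and is taken to be
    [R * R]. *)
Definition unit_disc (R : realType) : set (R * R) :=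
  [set z | z.1 ^+ 2 + z.2 ^+ 2 < 1].

Definition open_topological_disc (R : realType) (D : set (R * R)) : Prop :=
  open D /\ homeomorphic_sets D (@unit_disc R).

(** Simplices are given by their vertex sets; every element of [V] is a
    vertex, so that [V] is K^0. *)
Definition simplicial_complex (V : choiceType) (K : set {fset V}) : Prop :=
  [/\ forall s, K s -> s != fset0,
      forall s t, K s -> t != fset0 -> (t `<=` s)%fset -> K t
    & forall v, K [fset v]%fset].

Definition locally_finite (V : choiceType) (K : set {fset V}) : Prop :=
  forall v, finite_set [set s | K s /\ v \in s].

Definition dimension_le2 (V : choiceType) (K : set {fset V}) : Prop :=
  forall s, K s -> (#|` s| <= 3)%N.

(** No edge lies on the boundary: each one is a side of exactly two triangles. *)
Definition without_boundary (V : choiceType) (K : set {fset V}) : Prop :=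
  forall e, K e -> #|` e| = 2%N ->
    ([set t | [/\ K t, #|` t| = 3%N & (e `<=` t)%fset]] #= `I_2)%card.

(** Points of |K| are given by their barycentric coordinates. The realization
    carries the topology of pointwise convergence of the coordinates; for a
    locally finite complex this is the usual topology (the weak and the metric
    topologies coincide with it). *)
Definition realization (R : realType) (V : choiceType) (K : set {fset V}) :
    set {ptws V -> R} :=
  [set x | exists2 s, K s &
    [/\ forall v, 0 <= x v, forall v, v \notin s -> x v = 0
      & \sum_(v <- s) x v = 1]].

Definition triangulation_of_open_disc (R : realType) (V : choiceType)
    (K : set {fset V}) : Prop :=
  [/\ simplicial_complex K, dimension_le2 K, infinite_set [set: V],
      locally_finite K & without_boundary K]
  /\ exists D : set (R * R),
       open_topological_disc D /\ homeomorphic_sets (@realization R V K) D.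

Definition adj (V : choiceType) (K : set {fset V}) (u v : V) : Prop :=
  u <> v /\ K [fset u; v]%fset.

(** [fset_set] is [fset0] on infinite sets, so [nbrs], [deg] and what is built
    on them are meaningful for locally finite complexes only. *)
Definition nbrs (V : choiceType) (K : set {fset V}) (v : V) : {fset V} :=
  fset_set [set u | adj K v u].

Definition deg (V : choiceType) (K : set {fset V}) (v : V) : nat :=
  #|` nbrs K v|.

Definition bounded_degree (V : choiceType) (K : set {fset V}) : Prop :=
  exists d : nat, forall v, (deg K v <= d)%N.

Definition srw_step (R : realType) (V : choiceType) (K : set {fset V})
    (u v : V) : R :=
  if v \in nbrs K u then (deg K u)%:R^-1 else 0.

(** The state space is discrete: a random vertex is a map all of whose fibers
    are events. *)
Definition simple_random_walk (R : realType) (V : choiceType)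
    (K : set {fset V}) (v0 : V) (d : measure_display) (Omega : measurableType d)
    (P : probability Omega R) (X : nat -> Omega -> V) : Prop :=
  [/\ forall n v, measurable [set w | X n w = v],
      P [set w | X 0%N w = v0] = 1%E
    & forall (n : nat) (x : nat -> V),
        P [set w | forall i, (i <= n.+1)%N -> X i w = x i] =
        (P [set w | forall i, (i <= n)%N -> X i w = x i]
         * (srw_step R K (x n) (x n.+1))%:E)%E].

Definition recurrent (R : realType) (V : choiceType) (K : set {fset V}) :
    Prop :=
  forall (v0 : V) (d : measure_display) (Omega : measurableType d)
    (P : probability Omega R) (X : nat -> Omega -> V),
    simple_random_walk K v0 P X ->
    forall v, P [set w | forall N, exists2 n, (N <= n)%N & X n w = v] = 1%E.

Definition transient (R : realType) (V : choiceType) (K : set {fset V}) :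
    Prop := ~ recurrent R K.

Definition harmonic_function (R : realType) (V : choiceType) (K : set {fset V})
    (f : V -> R) : Prop :=
  forall v, f v = (deg K v)%:R^-1 * \sum_(u <- nbrs K v) f u.

(** Each undirected edge is counted once per orientation, hence the factor
    1/2. *)
Definition dirichlet_energy (R : realType) (V : choiceType)
    (K : set {fset V}) (f : V -> R) : \bar R :=
  ((2^-1)%:E
   * \esum_(p in [set p : V * V | adj K p.1 p.2]) ((f p.1 - f p.2) ^+ 2)%:E)%E.

Definition dirichlet_finite (R : realType) (V : choiceType)
    (K : set {fset V}) (f : V -> R) : Prop :=
  (dirichlet_energy K f < +oo)%E.

(* Main.v *)
Require Import Defs.
From mathcomp Require Import all_boot all_order all_algebra.
From mathcomp Require Import finmap.
From mathcomp Require Import all_classical all_reals all_analysis.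
From mathcomp Require Import ring lra.
Set Implicit Arguments.
Unset Strict Implicit.
Unset Printing Implicit Defensive.
Import Order.TTheory GRing.Theory Num.Theory.
Import numFieldNormedType.Exports.
Local Open Scope classical_set_scope.
Local Open Scope ring_scope.

(** The idea is the one behind square tilings of planar graphs. As the walk is
    transient, some vertex [o] has positive capacity ([transient_capacity]),
    and there is a Green function [g] with pole [o] ([green_function]).
    Normalize its gradient to a flow [i] of finite energy, whose divergence is
    a full turn, up to sign, at [o] and zero elsewhere. In a disc, a flow
    without divergence is the jump, across the edges, of a function on the
    triangles. A full turn is trivial for angles, so here the flow is the jump
    of a multivalued angle [h] ([primitive_mod_ex]). Planarity enters there
    through two facts: links are connected ([link_connected]), and a local
    system over the plane has a global section ([trivial_monodromy]). No
    orientation is fixed, as only quantities that are even or odd under a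
    change of orientation matter.

    Reading [cos h] at some triangle of each vertex gives a bounded function
    [f], of finite energy since the degrees are bounded: around a vertex, [h]
    varies by at most the sum of [|i|] over the edges there
    ([link_oscillation]). Minimizing the energy among the functions that
    differ from [f] at finitely many vertices gives functions [u_n] whose
    limit is harmonic and of finite energy ([minimizer_limit]), and it remains
    to see that this limit is not constant.

    Think of each edge as covering an interval of angles of length [|i|]; the
    flow lines of [i] at a given angle lead to infinity, and [cos h] tends to
    the cosine of that angle along them, for the intervals become small. So
    [f] has different limits in different directions. Quantitatively, consider
    the flow [om] across edges of [sin h], which has finite energy and no
    divergence. It is orthogonal to the gradients of finitely supported
    functions, in particular to that of [u_n chi] for a cutoff [chi], equal to
    1 on a large finite set. In the product rule for [grad (u_n chi)], the
    term [om chi grad u_n] tends to 0 if the limit of [u_n] is constant, as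
    [om] has finite energy. In the other term, [om u_n grad chi], one has [u_n
    = f], since [chi] is equal to 1 where they differ, and [om f] is close to
    the integral of [cos ^ 2] over the interval of angles covered by the edge
    ([flow_estimate]). The latter is a flow whose divergence is half a turn,
    up to sign, at [o], as the mean of [cos ^ 2] is [1 / 2], and zero
    elsewhere; so it pairs with [grad chi] to a nonzero constant, a
    contradiction. For the error to be small, [|i| |grad chi|] must have a
    bounded sum, which is why [chi] is built from the level sets of [g]. *)

(** * Local constancy in the plane *)

(** Compactness of a segment as an induction principle: a property of intervals
    that holds for the short ones around each point and is stable under
    concatenation holds for the whole segment. The supremum of the points
    reachable from [a] is reachable and cannot be less than [b]. *)
Lemma segment_chain (R : realType) (Q : R -> R -> Prop) (a b : R) : a <= b ->
  (forall x y z, a <= x -> x <= y -> y <= z -> z <= b ->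
     Q x y -> Q y z -> Q x z) ->
  (forall x, a <= x -> x <= b -> exists2 d, 0 < d &
     forall y z, a <= y -> x - d < y -> y <= x -> x <= z -> z < x + d -> z <= b ->
       Q y z) ->
  Q a b.
Proof.
move=> ab Qadd Qloc.
pose A := [set x | [/\ a <= x, x <= b & Q a x]].
have Aa : A a.
  have [d d0 Hd] := Qloc a (lexx a) ab.
  by split=> //; apply: Hd => //; lra.
have Asup : has_sup A by split; [exists a | exists b => x []].
have [sa sb] : a <= sup A /\ sup A <= b.
  split; first by apply: ub_le_sup => //; case: Asup.
  by apply: ge_sup; [exists a| move=> x []].
have [d d0 Hd] := Qloc _ sa sb.
have [x Ax xs] := sup_adherent d0 Asup.
have xsup : x <= sup A by apply: ub_le_sup => //; case: Asup.
have key y : sup A <= y -> y < sup A + d -> y <= b -> A y.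
  case: Ax => ax xb Qax sy ysd yb; split=> //; first by lra.
  by apply: (Qadd a x y) => //; [lra | apply: Hd].
have [sltb|sgeb] := ltP (sup A) b.
  have : A (Num.min b (sup A + d / 2)).
    apply: key; rewrite ?le_min ?gt_min ?ge_min; [apply/andP; split; lra| |lra].
    by apply/orP; right; lra.
  move=> /(ub_le_sup Asup.2); rewrite ge_min => /orP[]; lra.
have -> : b = sup A by apply/eqP; rewrite eq_le sb sgeb.
by have [] := key (sup A) (lexx _) (ltac:(lra)) sb.
Qed.

(** The type [F] of values is often [Prop]: a connectedness argument then
    consists in showing that a proposition is locally constant. *)
Lemma segment_const (R : realType) (F : Type) (g : R -> F) (a b : R) : a <= b ->
  (forall x, a <= x -> x <= b -> exists2 d, 0 < d &
     forall y, a <= y -> y <= b -> `|y - x| < d -> g y = g x) -> g a = g b.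
Proof.
move=> ab loc; apply: (@segment_chain _ (fun x y => g x = g y) a b ab).
  by move=> x y z _ _ _ _ -> .
move=> x ax xb; have [d d0 Hd] := loc x ax xb; exists d => // y z *.
rewrite (Hd y) ?(Hd z) //; rewrite ?ltr_norml; lra.
Qed.

Definition box (R : realType) (a b c d : R) : set (R * R) :=
  [set z | (a <= z.1 <= b) && (c <= z.2 <= d)].

Definition loc_const (R : realType) (F : Type) (B : set (R * R)) (g : R * R -> F) :=
  forall z, B z -> exists2 d, 0 < d &
    forall z', B z' -> `|z'.1 - z.1| < d -> `|z'.2 - z.2| < d -> g z' = g z.

Lemma loc_const_horizontal (R : realType) (F : Type) (B : set (R * R))
    (g : R * R -> F) (x x' y : R) : loc_const B g ->
  (forall t, x <= t <= x' \/ x' <= t <= x -> B (t, y)) -> g (x, y) = g (x', y).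
Proof.
move=> lc; wlog xx' : x x' / x <= x'.
  move=> W HB; have [/W|/ltW/W] := leP x x'; first exact.
  by move=> W'; rewrite W' // => t [|] ?; apply: HB; [right|left].
move=> HB; apply: (@segment_const _ _ (fun t => g (t, y)) x x' xx') => t xt tx'.
have Bt : B (t, y) by apply: HB; left; apply/andP.
have [d d0 Hd] := lc _ Bt; exists d => // t' xt' tx'' tt'.
apply: Hd => //=; last by rewrite subrr normr0.
by apply: HB; left; apply/andP.
Qed.

Lemma loc_const_vertical (R : realType) (F : Type) (B : set (R * R))
    (g : R * R -> F) (x y y' : R) : loc_const B g ->
  (forall t, y <= t <= y' \/ y' <= t <= y -> B (x, t)) -> g (x, y) = g (x, y').
Proof.
move=> lc HB.
pose sw (z : R * R) := (z.2, z.1).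
apply: (@loc_const_horizontal _ _ (B \o sw) (g \o sw) y y' x) => // z Bz.
have [d d0 Hd] := lc _ Bz; exists d => // z' Bz' z1 z2; exact: Hd.
Qed.

Lemma loc_const_box (R : realType) (F : Type) (g : R * R -> F) (a b c d : R) :
  loc_const (box a b c d) g ->
  forall z z', box a b c d z -> box a b c d z' -> g z = g z'.
Proof.
move=> lc [x y] [x' y'] /andP/=[/andP[? ?] /andP[? ?]] /andP/=[/andP[? ?] /andP[? ?]].
rewrite (@loc_const_horizontal _ _ _ _ x x' y lc).
  apply: (loc_const_vertical lc) => t [|] /andP[? ?]; rewrite /box/=; lra.
by move=> t [|] /andP[? ?]; rewrite /box/=; lra.
Qed.

(** A punctured square is connected: every point reaches the upper right corner
    along two sides parallel to the axes, the first one chosen off the centre. *)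
Lemma loc_const_punctured_box (R : realType) (F : Type) (g : R * R -> F)
    (c : R * R) (r : R) :
  loc_const [set z | [/\ `|z.1 - c.1| <= r, `|z.2 - c.2| <= r & z != c]] g ->
  forall z z', z != c -> z' != c ->
    `|z.1 - c.1| <= r -> `|z.2 - c.2| <= r ->
    `|z'.1 - c.1| <= r -> `|z'.2 - c.2| <= r -> g z = g z'.
Proof.
move=> lc.
suff corner z : z != c -> `|z.1 - c.1| <= r -> `|z.2 - c.2| <= r ->
    g z = g (c.1 + r, c.2 + r).
  by move=> z z' ? ? ? ? ? ?; rewrite (corner z) ?(corner z').
case: c lc z => c1 c2 lc [x y] /= zc.
rewrite !ler_norml => /andP[x1 x2] /andP[y1 y2].
have nB u v : (u, v) != (c1, c2) = (u != c1) || (v != c2).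
  by rewrite -pair_eqE /= negb_and.
have [xc|xc] := eqVneq x c1.
  have yc : y != c2 by move: zc; rewrite nB xc eqxx.
  rewrite (@loc_const_horizontal _ _ _ _ x (c1 + r) y lc).
    apply: (loc_const_vertical lc) => t /= Ht; rewrite nB !ler_norml.
    split; [lra|case: Ht => /andP[? ?]; lra|].
    have [r0|r0] := eqVneq (c1 + r) c1; last by [].
    by have : y = c2 by [lra]; move/eqP: yc.
  move=> t Ht /=; rewrite nB yc orbT !ler_norml.
  by split => //; case: Ht => /andP[? ?]; lra.
rewrite (@loc_const_vertical _ _ _ _ x y (c2 + r) lc).
  apply: (loc_const_horizontal lc) => t /= Ht; rewrite nB !ler_norml.
  split; [case: Ht => /andP[? ?]; lra|lra|].
  have [r0|r0] := eqVneq (c2 + r) c2; last by rewrite orbT.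
  by have : x = c1 by [lra]; move/eqP: xc.
move=> t Ht /=; rewrite nB xc !ler_norml.
by split => //; case: Ht => /andP[? ?]; lra.
Qed.

(** * Charts of a triangulated plane *)

(** Barycentric coordinates of the point that divides the edge [uv] in the
    proportion [t]; it is the vertex [u] when [t = 0], or when [u = v]. *)
Definition edge_point (R : realType) (V : choiceType) (u v : V) (t : R) (w : V) : R :=
  (1 - t) * (w == u)%:R + t * (w == v)%:R.

(** A homeomorphism [p] from the plane onto the realization, with inverse [q].
    Of continuity only two consequences are recorded: open stars of vertices
    are open in the plane, and [q] is continuous along edges. A vertex is
    called active at [z] when [z] lies in its open star. *)
Record plane_chart (R : realType) (V : choiceType) (K : set {fset V})
    (p : R * R -> V -> R) (q : (V -> R) -> R * R) : Prop := PlaneChart {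
  chart_complex : simplicial_complex K;
  chart_real : forall z, realization K (p z);
  chart_open : forall z v, 0 < p z v -> exists2 d, 0 < d &
    forall z', `|z'.1 - z.1| < d -> `|z'.2 - z.2| < d -> 0 < p z' v;
  chart_pK : forall z, q (p z) = z;
  chart_qK : forall x, realization K x -> p (q x) = x;
  chart_edge : forall u v, K [fset u; v]%fset -> forall t, 0 <= t <= 1 ->
    forall e, 0 < e -> exists2 d, 0 < d & forall t', 0 <= t' <= 1 ->
    `|t' - t| < d -> `|(q (edge_point u v t')).1 - (q (edge_point u v t)).1| < e /\
                     `|(q (edge_point u v t')).2 - (q (edge_point u v t)).2| < e }.

Section Chart.
Context (R : realType) (V : choiceType) (K : set {fset V}).
Context (p : R * R -> V -> R) (q : (V -> R) -> R * R) (hp : plane_chart K p q).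

Lemma complex_sub s t : K s -> t != fset0 -> (t `<=` s)%fset -> K t.
Proof. by case: (chart_complex hp) => _ H _; apply: H. Qed.

Lemma active_ex z : exists v, 0 < p z v.
Proof.
have [s Ks [p0 ps sum1]] := chart_real hp z.
apply: contrapT => nex; have : \sum_(v <- s) p z v = 0.
  apply: big1_seq => v _; apply/eqP; rewrite eq_le p0 andbT leNgt.
  by apply/negP => ?; apply: nex; exists v.
by rewrite sum1 => /eqP; rewrite oner_eq0.
Qed.

Lemma active_simplex z (t : {fset V}) : t != fset0 ->
  (forall v, v \in t -> 0 < p z v) -> K t.
Proof.
move=> t0 Ht; have [s Ks [p0 ps _]] := chart_real hp z.
apply: (complex_sub Ks) => //; apply/fsubsetP => v /Ht.
by apply: contraTT => /ps ->; rewrite ltxx.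
Qed.

Lemma active2 z u v : 0 < p z u -> 0 < p z v -> K [fset u; v]%fset.
Proof.
move=> zu zv; apply: (@active_simplex z).
  by apply/fset0Pn; exists u; rewrite !inE eqxx.
by move=> w; rewrite !inE => /orP[] /eqP ->.
Qed.

Lemma active3 z u v w : 0 < p z u -> 0 < p z v -> 0 < p z w ->
  K [fset u; v; w]%fset.
Proof.
move=> zu zv zw; apply: (@active_simplex z).
  by apply/fset0Pn; exists u; rewrite !inE eqxx.
by move=> x; rewrite !inE -orbA => /or3P[] /eqP ->.
Qed.

Lemma edge_point_active (u v : V) (t : R) w :
  0 < edge_point u v t w -> w = u \/ w = v.
Proof.
rewrite /edge_point; case: eqVneq => [->|_]; first by left.
by case: eqVneq => [->|_]; [right | rewrite !mulr0 addr0 ltxx].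
Qed.

Lemma realization_edge u v (t : R) : K [fset u; v]%fset -> 0 <= t <= 1 ->
  realization K (edge_point u v t).
Proof.
move=> Kuv t01; exists [fset u; v]%fset => //; split.
- by move=> w; rewrite /edge_point; do 2!case: eqVneq => _ /=; lra.
- move=> w; rewrite !inE negb_or => /andP[/negPf wu /negPf wv].
  by rewrite /edge_point wu wv !mulr0 addr0.
rewrite /edge_point big_split /= -!mulr_sumr.
have sum1 x : x \in [fset u; v]%fset -> \sum_(w <- [fset u; v]%fset) (w == x)%:R = 1 :> R.
  move=> xuv; rewrite (bigD1_seq x) //= ?fset_uniq // eqxx big1 ?addr0 //.
  by move=> w /negPf ->.
by rewrite !sum1 ?inE ?eqxx ?orbT //; lra.
Qed.

Definition vertex_point (v : V) : R * R := q (edge_point v v 0).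

Lemma vertex_simplex v : K [fset v]%fset.
Proof. by case: (chart_complex hp). Qed.

Lemma vertex_edge v : K [fset v; v]%fset.
Proof. by rewrite fsetUid; apply: vertex_simplex. Qed.

Lemma p_edge u v (t : R) : K [fset u; v]%fset -> 0 <= t <= 1 ->
  p (q (edge_point u v t)) = edge_point u v t.
Proof. by move=> Kuv t01; apply/(chart_qK hp)/realization_edge. Qed.

Lemma vertex_point_active v w : 0 < p (vertex_point v) w <-> w = v.
Proof.
rewrite /vertex_point p_edge ?lexx ?ler01 //; last exact: vertex_edge.
split=> [|->]; last by rewrite /edge_point eqxx /=; lra.
by case/edge_point_active.
Qed.

Lemma edge_point0 (u v : V) : edge_point u v 0 = edge_point u u 0 :> (V -> R).
Proof. by apply/funext => w; rewrite /edge_point !mul0r. Qed.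
Lemma edge_point1 (u v : V) : edge_point u v 1 = edge_point v v 0 :> (V -> R).
Proof. by apply/funext => w; rewrite /edge_point subrr subr0 !mul0r mul1r add0r addr0. Qed.

Lemma loc_const_plane (F : Type) (g : R * R -> F) :
  loc_const setT g -> forall z z', g z = g z'.
Proof.
move=> lc z z'.
pose N := `|z.1| + `|z.2| + `|z'.1| + `|z'.2|.
have H x : (x == z.1) || (x == z.2) || (x == z'.1) || (x == z'.2) -> - N <= x <= N.
  move=> Hx; have : `|x| <= N.
    have := normr_ge0 z.1; have := normr_ge0 z.2.
    have := normr_ge0 z'.1; have := normr_ge0 z'.2.
    by rewrite /N; case/orP: Hx => [/orP[/orP[]|]|] /eqP ->; lra.
  by rewrite ler_norml.
apply: (@loc_const_box _ _ g (-N) N (-N) N); rewrite /box /= ?H ?eqxx ?orbT //.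
by move=> x _; have [d d0 Hd] := lc x I; exists d => // ? _; apply: Hd.
Qed.

(** At each point of the plane the active vertices are pairwise adjacent, so a
    set of vertices closed under adjacency contains all of them or none; which
    of the two is locally constant on the plane. *)
Lemma skeleton_connected (A : V -> Prop) (o : V) : A o ->
  (forall u v, A u -> K [fset u; v]%fset -> A v) -> forall v, A v.
Proof.
move=> Ao Aadj v.
pose g z := exists2 u, 0 < p z u & A u.
have gE z u : 0 < p z u -> g z = A u.
  move=> zu; apply/propext; split; last by exists u.
  by move=> [w zw Aw]; apply: (Aadj w) => //; apply: active2 zw zu.
rewrite -(gE (vertex_point v) v); last by apply/vertex_point_active.
rewrite (@loc_const_plane _ g _ _ (vertex_point o)).
  by rewrite (gE _ o) //; apply/vertex_point_active.
move=> z _; have [u zu] := active_ex z.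
have [d d0 Hd] := chart_open hp zu; exists d => // z' _ z1 z2.
by rewrite (gE _ _ zu) (gE _ u) //; apply: Hd.
Qed.

(** The link of a vertex is connected: a small square around the vertex stays
    connected when its centre is removed, and each of its other points has an
    active vertex in the link. *)
Lemma link_connected (v : V) (A : V -> Prop) (a : V) : A a ->
  a != v -> K [fset v; a]%fset ->
  (forall b c, A b -> b != v -> c != v -> K [fset v; b; c]%fset -> A c) ->
  forall b, b != v -> K [fset v; b]%fset -> A b.
Proof.
move=> Aa av Kva Aadj b bv Kvb.
pose c := vertex_point v.
have [d d0 Hd] := chart_open hp (iffRL (vertex_point_active v v) erefl).
pose g z := exists u, [/\ 0 < p z u, u != v & A u].
have gE z u : 0 < p z v -> 0 < p z u -> u != v -> g z = A u.
  move=> zv zu uv; apply/propext; split; last by exists u.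
  by move=> [w [zw wv Aw]]; apply: (Aadj w) => //; apply: active3 zv zw zu.
have other z : z != c -> exists2 u, 0 < p z u & u != v.
  move=> zc; apply: contrapT => nex.
  have eqz : p z = edge_point v v 0.
    have [s Ks [p0 ps sum1]] := chart_real hp z.
    have z0 u : u != v -> p z u = 0.
      move=> uv; apply/eqP; rewrite eq_le p0 andbT leNgt; apply/negP => zu.
      by apply: nex; exists u.
    have vs : v \in s.
      apply/negPn/negP => vs; move: sum1; rewrite big1_seq ?oner_eq0.
        by move/eqP; rewrite eq_sym oner_eq0.
      move=> u /= us; apply: z0; apply: contraNneq vs => <-; exact: us.
    apply/funext => u; rewrite /edge_point.
    have [->|uv] := eqVneq u v; last by rewrite z0 // !mulr0 addr0.
    move: sum1; rewrite (bigD1_seq v) ?fset_uniq //= big1 ?addr0 => [->|]; first lra.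
    by move=> w wv; apply: z0.
  by move: zc; rewrite /c /vertex_point -eqz (chart_pK hp) eqxx.
have near_a x : x != v -> K [fset v; x]%fset -> exists z,
    [/\ `|z.1 - c.1| <= d / 2, `|z.2 - c.2| <= d / 2, z != c & g z = A x].
  move=> xv Kvx.
  have [e e0 He] := chart_edge hp Kvx (ltac:(lra) : 0 <= (0:R) <= 1) (ltac:(lra) : 0 < d / 2).
  pose t : R := Num.min 1 (e / 2).
  have t0 : 0 < t by rewrite lt_min; lra.
  have t1 : t <= 1 by rewrite ge_min lexx.
  have te : t < e by rewrite gt_min; apply/orP; right; lra.
  have [||H1 H2] := He t; [lra|rewrite subr0 gtr0_norm//|].
  exists (q (edge_point v x t)); rewrite edge_point0 in H1 H2.
  have pt : p (q (edge_point v x t)) = edge_point v x t by apply: p_edge => //; lra.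
  have Px : 0 < p (q (edge_point v x t)) x.
    by rewrite pt /edge_point eqxx (negPf xv) /=; lra.
  have Hvd : 0 < p (q (edge_point v x t)) v.
    by apply: Hd; rewrite -/c; [move: H1|move: H2]; rewrite /c/vertex_point; lra.
  split; [exact: ltW|exact: ltW| |].
  - apply/eqP => E; move: Px; rewrite E => /vertex_point_active/eqP; exact/negP.
  - by apply: gE.
have [za [a1 a2 ac ga]] := near_a a av Kva.
have [zb [b1 b2 bc gb]] := near_a b bv Kvb.
rewrite -gb -(@loc_const_punctured_box _ _ g c (d/2) _ za zb) ?ga //.
move=> z /= [z1 z2 zc]; have [u zu uv] := other z zc.
have [e e0 He] := chart_open hp zu.
have zv : 0 < p z v by apply: Hd; rewrite -/c; lra.
exists e => // z' /= [z'1 z'2 z'c] h1 h2.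
rewrite (gE _ _ zv zu uv) (gE _ u) //; last exact: He.
by apply: Hd; rewrite -/c; lra.
Qed.

End Chart.

(** * Local systems over a triangulated plane have sections *)

(** The fibre over [v] consists of the elements that satisfy [Sec v]. The last
    axiom, in which vertices may coincide, makes transport invertible and flat
    over triangles. *)
Record local_system (V : choiceType) (K : set {fset V}) (T : Type)
    (Sec : V -> T -> Prop) (rho : V -> V -> T -> T) : Prop := LocalSystem {
  transport_sec : forall u v s, K [fset u; v]%fset -> Sec u s -> Sec v (rho u v s);
  transport_id : forall u s, Sec u s -> rho u u s = s;
  transport_comp : forall u v w s, K [fset u; v; w]%fset -> Sec u s ->
    rho v w (rho u v s) = rho u w s }.

Section Monodromy.
Context (R : realType) (V : choiceType) (K : set {fset V}).
Context (p : R * R -> V -> R) (q : (V -> R) -> R * R) (hp : plane_chart K p q).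
Context (T : Type) (Sec : V -> T -> Prop) (rho : V -> V -> T -> T).
Context (hrho : local_system K Sec rho).

(** A germ at a point is given by one representative in the fibre over each
    active vertex, the representatives being related by transport; a section
    is locally constant in each of these coordinates. *)
Definition section_on (B : set (R * R)) (sg : R * R -> V -> T) : Prop :=
  [/\ forall z v, B z -> 0 < p z v -> Sec v (sg z v),
      forall z u v, B z -> 0 < p z u -> 0 < p z v -> sg z v = rho u v (sg z u)
    & forall z v, B z -> 0 < p z v -> exists2 d, 0 < d &
        forall z', B z' -> `|z'.1 - z.1| < d -> `|z'.2 - z.2| < d ->
          sg z' v = sg z v].

(** Existence of sections with a prescribed germ. In this form it is inherited
    by a union of two sets with connected intersection. *)
Definition extends_germs (B : set (R * R)) : Prop :=
  forall z v s, B z -> 0 < p z v -> Sec v s ->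
    exists2 sg, section_on B sg & sg z v = s.

Lemma section_sub (B B' : set (R * R)) sg :
  B' `<=` B -> section_on B sg -> section_on B' sg.
Proof.
move=> BB' [h1 h2 h3]; split.
- by move=> z v /BB'; apply: h1.
- by move=> z u v /BB'; apply: h2.
by move=> z v /BB' Bz /(h3 _ _ Bz) [d d0 Hd]; exists d => // z' /BB'; apply: Hd.
Qed.

Lemma section_eq_active (B : set (R * R)) sg sg' z u v : section_on B sg ->
  section_on B sg' -> B z -> 0 < p z u -> 0 < p z v -> sg z u = sg' z u ->
  sg z v = sg' z v.
Proof.
move=> [_ h _] [_ h' _] Bz zu zv E.
by rewrite (h z u v) // (h' z u v) // E.
Qed.

Lemma section_agree_loc_const (B : set (R * R)) sg sg' : section_on B sg ->
  section_on B sg' ->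
  loc_const B (fun z => exists2 v, 0 < p z v & sg z v = sg' z v).
Proof.
move=> hs hs' z Bz; have [u zu] := active_ex hp z.
have [d d0 Hd] := chart_open hp zu.
have [_ _ /(_ z u Bz zu) [d1 d10 Hd1]] := hs.
have [_ _ /(_ z u Bz zu) [d2 d20 Hd2]] := hs'.
have E z' : B z' -> 0 < p z' u ->
    (exists2 v, 0 < p z' v & sg z' v = sg' z' v) = (sg z' u = sg' z' u).
  move=> Bz' zu'; apply/propext; split; last by exists u.
  by move=> [v zv Ev]; apply: (@section_eq_active B sg sg' z' v u).
exists (Num.min d (Num.min d1 d2)); first by rewrite !lt_min d0 d10 d20.
move=> z' Bz'; rewrite !lt_min => /and3P[a1 a2 a3] /and3P[b1 b2 b3].
by rewrite (E z) // (E z') ?Hd1 ?Hd2 //; apply: Hd.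
Qed.

(** Agreement of two sections is locally constant. *)
Lemma section_unique_box a b c d sg sg' z0 v0 :
  section_on (box a b c d) sg -> section_on (box a b c d) sg' ->
  box a b c d z0 -> 0 < p z0 v0 -> sg z0 v0 = sg' z0 v0 ->
  forall z v, box a b c d z -> 0 < p z v -> sg z v = sg' z v.
Proof.
move=> hs hs' Bz0 zv0 E z v Bz zv.
have /= := loc_const_box (section_agree_loc_const hs hs') Bz0 Bz.
set X := ex2 _ _; set Y := ex2 _ _ => XY.
have : Y by rewrite -XY; exists v0.
by move=> [w zw Ew]; apply: (@section_eq_active _ sg sg' z w v hs hs').
Qed.

Definition box_closed (B : set (R * R)) := forall z, ~ B z -> exists2 d, 0 < d &
  forall z', `|z'.1 - z.1| < d -> `|z'.2 - z.2| < d -> ~ B z'.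

Lemma section_glue (B1 B2 : set (R * R)) sg1 sg2 :
  box_closed B1 -> box_closed B2 -> section_on B1 sg1 -> section_on B2 sg2 ->
  (forall z v, B1 z -> B2 z -> 0 < p z v -> sg1 z v = sg2 z v) ->
  exists2 sg, section_on (B1 `|` B2) sg &
   (forall z v, B1 z -> 0 < p z v -> sg z v = sg1 z v) /\
   (forall z v, B2 z -> 0 < p z v -> sg z v = sg2 z v).
Proof.
move=> c1 c2 h1 h2 E.
pose sg z v := if asbool (B1 z) then sg1 z v else sg2 z v.
have s1 z v : B1 z -> sg z v = sg1 z v by move=> B1z; rewrite /sg asboolT.
have s2 z v : B2 z -> 0 < p z v -> sg z v = sg2 z v.
  by move=> B2z zv; rewrite /sg; case: asboolP => // B1z; apply: E.
exists sg; last first.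
  by split=> z v Bz zv; [exact: s1 | exact: s2].
have [a1 b1 d1] := h1; have [a2 b2 d2] := h2.
have near_of (B : set (R * R)) s z v : box_closed B ->
    (B z -> exists2 d, 0 < d & forall z', B z' -> `|z'.1 - z.1| < d ->
       `|z'.2 - z.2| < d -> s z' v = s z v) -> (B z -> sg z v = s z v) ->
    (forall z', B z' -> 0 < p z' v -> sg z' v = s z' v) ->
    exists2 d, 0 < d & forall z', B z' -> 0 < p z' v -> `|z'.1 - z.1| < d ->
       `|z'.2 - z.2| < d -> sg z' v = sg z v.
  move=> cB lc Ez Ez'; have [Bz|nBz] := pselect (B z).
    have [d d0 Hd] := lc Bz; exists d => // z' Bz' zv' ? ?.
    by rewrite Ez' // Ez // Hd.
  by have [d d0 Hd] := cB _ nBz; exists d => // z' Bz' _ ? ?; case: (Hd z').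
split.
- move=> z v [Bz|Bz] zv; [by rewrite s1//; apply: a1|by rewrite s2//; apply: a2].
- move=> z u v [Bz|Bz] zu zv; [by rewrite !s1//; apply: b1|by rewrite !s2//; apply: b2].
move=> z v Bz zv; have [e e0 He] := chart_open hp zv.
have [e1 e10 He1] := near_of B1 sg1 z v c1 (fun B => d1 _ _ B zv)
  (fun B => s1 _ _ B) (fun z' B _ => s1 _ _ B).
have [e2 e20 He2] := near_of B2 sg2 z v c2 (fun B => d2 _ _ B zv)
  (fun B => s2 _ _ B zv) (fun z' B zv' => s2 _ _ B zv').
exists (Num.min e (Num.min e1 e2)); first by rewrite !lt_min e0 e10 e20.
move=> z' Bz'; rewrite !lt_min => /and3P[? ? ?] /and3P[? ? ?].
have zv' : 0 < p z' v by apply: He.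
by case: Bz' => Bz'; [apply: He1 | apply: He2].
Qed.

Lemma box_is_closed a b c d : box_closed (@box R a b c d).
Proof.
move=> z nBz.
have H : [\/ z.1 < a, b < z.1, z.2 < c | d < z.2].
  apply: contrapT => nH; apply: nBz; rewrite /box /=.
  have ? : a <= z.1 by rewrite leNgt; apply/negP => ?; apply: nH; constructor 1.
  have ? : z.1 <= b by rewrite leNgt; apply/negP => ?; apply: nH; constructor 2.
  have ? : c <= z.2 by rewrite leNgt; apply/negP => ?; apply: nH; constructor 3.
  have ? : z.2 <= d by rewrite leNgt; apply/negP => ?; apply: nH; constructor 4.
  by apply/andP; split; apply/andP.
case: H => H.
- exists (a - z.1); first by lra.
  by move=> z'; rewrite !ltr_norml /box /= => /andP[? ?] _; apply/negP; lra.
- exists (z.1 - b); first by lra.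
  by move=> z'; rewrite !ltr_norml /box /= => /andP[? ?] _; apply/negP; lra.
- exists (c - z.2); first by lra.
  by move=> z'; rewrite !ltr_norml /box /= => _ /andP[? ?]; apply/negP; lra.
- exists (z.2 - d); first by lra.
  by move=> z'; rewrite !ltr_norml /box /= => _ /andP[? ?]; apply/negP; lra.
Qed.

(** Extend the germ over one set, then extend over the other the germ obtained
    at a point of the intersection; on the intersection, which is a box, the
    two sections agree by uniqueness. *)
Lemma extends_glue (B1 B2 : set (R * R)) a b c d :
  box_closed B1 -> box_closed B2 -> extends_germs B1 -> extends_germs B2 ->
  box a b c d !=set0 -> B1 `&` B2 = box a b c d -> extends_germs (B1 `|` B2).
Proof.
move=> c1 c2 e1 e2 [z1 Iz1] I.
have BI z : box a b c d z -> B1 z /\ B2 z by rewrite -I.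
have [v1 zv1] := active_ex hp z1.
have [B1z1 B2z1] := BI _ Iz1.
have main A1 A2 : box_closed A1 -> box_closed A2 -> extends_germs A1 ->
    extends_germs A2 -> A1 `&` A2 = box a b c d -> A1 z1 -> A2 z1 ->
    forall z v s, A1 z -> 0 < p z v -> Sec v s ->
    exists2 sg, section_on (A1 `|` A2) sg & sg z v = s.
  move=> k1 k2 f1 f2 J Az1 Az1' z v s Az zv Ss.
  have [sg1 h1 E1] := f1 z v s Az zv Ss.
  have [sg2 h2 E2] := f2 z1 v1 (sg1 z1 v1) Az1' zv1 (ltac:(by case: h1 => + _ _; apply)).
  have [sg hs [F1 F2]] : exists2 sg, section_on (A1 `|` A2) sg &
     (forall z v, A1 z -> 0 < p z v -> sg z v = sg1 z v) /\
     (forall z v, A2 z -> 0 < p z v -> sg z v = sg2 z v).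
    apply: section_glue => // z' v' Az' Az'' zv'.
    have JJ : box a b c d `<=` A1 /\ box a b c d `<=` A2.
      by rewrite -J; split=> x [].
    apply: (@section_unique_box a b c d sg1 sg2 z1 v1) => //.
    - by apply: section_sub h1; case: JJ.
    - by apply: section_sub h2; case: JJ.
    by rewrite -J.
  by exists sg => //; rewrite F1.
move=> z v s [Bz|Bz] zv Ss; first exact: main.
by rewrite setUC; apply: main => //; rewrite setIC.
Qed.

(** Inside the open star of [w], transport from [w] gives constant sections. *)
Lemma extends_local z : exists2 d, 0 < d & forall B : set (R * R),
  (forall z', B z' -> `|z'.1 - z.1| < d /\ `|z'.2 - z.2| < d) -> extends_germs B.
Proof.
have [w zw] := active_ex hp z; have [d d0 Hd] := chart_open hp zw.
exists d => // B HB z0 v0 s Bz0 zv0 Ss.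
have Bw z' : B z' -> 0 < p z' w by move=> /HB[? ?]; apply: Hd.
pose s' := rho v0 w s.
have Ss' : Sec w s'.
  by apply: (transport_sec hrho) => //; apply: (active2 hp zv0); apply: Bw.
exists (fun _ v => rho w v s'); last first.
  rewrite (transport_comp hrho) // ?(transport_id hrho) //.
  by apply: (active3 hp zv0) => //; apply: Bw.
split.
- move=> z' v Bz' zv; apply: (transport_sec hrho) => //.
  by apply: (active2 hp) zv; apply: Bw.
- move=> z' u v Bz' zu zv; rewrite (transport_comp hrho) //.
  by apply: (active3 hp) zu zv; apply: Bw.
by move=> z' v _ _; exists 1.
Qed.

(** Cut the box into thin vertical strips, and each strip into small boxes, by
    compactness of both sides. *)
Lemma extends_box a b c d : a <= b -> c <= d -> extends_germs (box a b c d).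
Proof.
move=> ab cd.
apply: (@segment_chain _ (fun x y => extends_germs (box x y c d)) a b ab).
  move=> x y z _ xy yz _ h1 h2.
  have -> : box x z c d = box x y c d `|` box y z c d.
    apply/seteqP; split => u; rewrite /box /=; last by case; lra.
    by have [?|?] := leP u.1 y => ?; [left|right]; lra.
  apply: (@extends_glue _ _ y y c d) => //; try exact: box_is_closed.
    by exists (y, c); rewrite /box /=; lra.
  by apply/seteqP; split => u; rewrite /box /=; [case|split]; lra.
move=> x ax xb.
suff [e e0 He] : exists2 e, 0 < e & forall y z, x - e < y -> y <= x -> x <= z ->
    z < x + e -> extends_germs (box y z c d).
  by exists e => // y z *; apply: He.
apply: (@segment_chain _ (fun s t => exists2 e, 0 < e & forall y z, x - e < y ->
   y <= x -> x <= z -> z < x + e -> extends_germs (box y z s t)) c d cd).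
  move=> s t r _ st tr _ [e1 e10 H1] [e2 e20 H2].
  exists (Num.min e1 e2); first by rewrite lt_min e10.
  move=> y z y1 y2 z1 z2.
  have [? ?] : Num.min e1 e2 <= e1 /\ Num.min e1 e2 <= e2.
    by rewrite !ge_min !lexx orbT.
  have -> : box y z s r = box y z s t `|` box y z t r.
    apply/seteqP; split => u; rewrite /box /=; last by case; lra.
    by have [?|?] := leP u.2 t => ?; [left|right]; lra.
  apply: (@extends_glue _ _ y z t t) => //; try exact: box_is_closed.
  - by apply: H1; lra.
  - by apply: H2; lra.
  - by exists (y, t); rewrite /box /=; lra.
  by apply/seteqP; split => u; rewrite /box /=; [case|split]; lra.
move=> t ct td; have [e e0 He] := extends_local (x, t).
exists e => // s r _ s1 s2 r1 r2 _; exists e => // y z y1 y2 z1 z2.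
by apply: He => u; rewrite /box /= !ltr_norml; lra.
Qed.

(** Sections over an increasing family of squares agree, hence define a section
    over the whole plane. *)
Lemma global_section z0 v0 s0 : 0 < p z0 v0 -> Sec v0 s0 ->
  exists2 sg, section_on setT sg & sg z0 v0 = s0.
Proof.
move=> zv0 Ss0.
pose N (z : R * R) := `|z.1| + `|z.2| + `|z0.1| + `|z0.2| + 1.
pose B n : set (R * R) := box (-n) n (-n) n.
have Bin n (z : R * R) : `|z.1| <= n -> `|z.2| <= n -> B n z.
  by rewrite /B /box /= !ler_norml => -> ->.
have NB n z : N z <= n -> B n z.
  move=> zn; have := normr_ge0 z.1; have := normr_ge0 z.2.
  by have := normr_ge0 z0.1; have := normr_ge0 z0.2; rewrite /N in zn;
     move=> *; apply: Bin; lra.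
have NB0 n z : N z <= n -> B n z0.
  move=> zn; have := normr_ge0 z.1; have := normr_ge0 z.2.
  by have := normr_ge0 z0.1; have := normr_ge0 z0.2; rewrite /N in zn;
     move=> *; apply: Bin; lra.
have ex n : exists sg, B n z0 -> section_on (B n) sg /\ sg z0 v0 = s0.
  have [Bz0|nB] := pselect (B n z0); last by exists (fun _ _ => s0).
  have n0 : -n <= n by move: Bz0; rewrite /B /box /=; lra.
  by have [sg h E] := extends_box n0 n0 Bz0 zv0 Ss0; exists sg.
have [S HS] := choice ex.
have agree n m z v : B n z0 -> n <= m -> B n z -> 0 < p z v -> S n z v = S m z v.
  move=> Bz0 nm Bz zv; have [h1 E1] := HS n Bz0.
  have sub : B n `<=` B m by move=> u; rewrite /B /box /=; lra.
  have [h2 E2] := HS m (sub _ Bz0).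
  by apply: (section_unique_box h1 (section_sub sub h2) Bz0 zv0) => //; rewrite E1.
exists (fun z v => S (N z) z v); last first.
  by have [_ ->] := HS (N z0) (NB0 _ z0 (lexx _)).
have secN z : section_on (B (N z)) (S (N z)) by have [] := HS _ (NB0 _ _ (lexx (N z))).
split.
- by move=> z v _ zv; have [h _ _] := secN z; apply: h => //; apply: NB.
- by move=> z u v _ zv; have [_ h _] := secN z; apply: h => //; apply: NB.
move=> z v _ zv; have [d d0 Hd] := chart_open hp zv.
pose n := N z + 2.
have zn : N z <= n by rewrite /n; lra.
have [h _] := HS n (NB0 _ _ zn).
have [_ _ /(_ z v (NB _ _ zn) zv) [e e0 He]] := h.
exists (Num.min 1 (Num.min d e)); first by rewrite !lt_min d0 e0 ltr01.
move=> z' _; rewrite !lt_min => /and3P[? ? ?] /and3P[? ? ?].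
have zv' : 0 < p z' v by apply: Hd.
have zn' : N z' <= n.
  have := ler_normD (z'.1 - z.1) z.1; have := ler_normD (z'.2 - z.2) z.2.
  by rewrite /n /N !subrK; lra.
rewrite (@agree _ n) //; [|exact: (NB0 _ _ (lexx _))|exact: NB].
rewrite (@agree _ n z) //; [|exact: (NB0 _ _ (lexx _))|exact: NB].
by apply: He => //; apply: NB.
Qed.

(** A local system over a triangulated plane has a global section: read a
    section over the plane at the vertices. Along the segment of the plane that
    represents an edge [uv], the section stays in the class of its value at
    [u]. *)
Lemma trivial_monodromy (o : V) (s0 : T) : Sec o s0 ->
  exists2 b : V -> T, b o = s0 & (forall v, Sec v (b v)) /\
    (forall u v, K [fset u; v]%fset -> b v = rho u v (b u)).
Proof.
move=> Ss0.
have ovo : 0 < p (vertex_point q o) o by apply/(vertex_point_active hp).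
have [sg hsg E] := global_section ovo Ss0.
have [sec tr lc] := hsg.
exists (fun v => sg (vertex_point q v) v) => //; split.
  by move=> v; apply: sec => //; apply/(vertex_point_active hp).
move=> u v Kuv.
pose b u := sg (vertex_point q u) u.
pose ga t := q (edge_point u v t).
pose A t := exists2 w, 0 < p (ga t) w & sg (ga t) w = rho u w (b u).
have Su : Sec u (b u) by apply: sec => //; apply/(vertex_point_active hp).
have pga t w : 0 <= t <= 1 -> 0 < p (ga t) w -> w = u \/ w = v.
  by move=> t01; rewrite /ga (p_edge hp) //; apply: edge_point_active.
have AE t w : 0 <= t <= 1 -> 0 < p (ga t) w -> A t = (sg (ga t) w = rho u w (b u)).
  move=> t01 tw; apply/propext; split; last by exists w.
  move=> [w' tw' E']; rewrite (tr _ w' w) // E' (transport_comp hrho) //.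
  apply: (complex_sub hp Kuv); first by apply/fset0Pn; exists u; rewrite !inE eqxx.
  apply/fsubsetP => x; rewrite !inE -orbA => /or3P[/eqP ->|/eqP ->|/eqP ->].
  - by rewrite eqxx.
  - by case: (pga _ _ t01 tw') => ->; rewrite eqxx ?orbT.
  - by case: (pga _ _ t01 tw) => ->; rewrite eqxx ?orbT.
have A01 : A 0 = A 1.
  apply: (@segment_const _ _ A) => // t t0 t1.
  have t01 : 0 <= t <= 1 by rewrite t0.
  have [w tw] := active_ex hp (ga t).
  have [d d0 Hd] := chart_open hp tw.
  have [e e0 He] := lc (ga t) w I tw.
  have [|f f0 Hf] := chart_edge hp Kuv t01 (e := Num.min d e).
    by rewrite lt_min d0.
  exists f => // t' t'0 t'1 tt'.
  have t'01 : 0 <= t' <= 1 by rewrite t'0.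
  have [] := Hf t' t'01 tt'; rewrite !lt_min => /andP[? ?] /andP[? ?].
  have tw' : 0 < p (ga t') w by apply: Hd.
  by rewrite (AE t w) // (AE t' w) // He.
have g0 : ga 0 = vertex_point q u by rewrite /ga edge_point0.
have g1 : ga 1 = vertex_point q v by rewrite /ga edge_point1.
have a0 : 0 < p (ga 0) u by rewrite g0; apply/(vertex_point_active hp).
have a1 : 0 < p (ga 1) v by rewrite g1; apply/(vertex_point_active hp).
move: A01; rewrite (AE 0 u) ?lexx ?ler01 // (AE 1 v) ?lexx ?ler01 //.
rewrite g0 g1 (transport_id hrho) // => H.
by rewrite -/(b v) -[b v]/(sg (vertex_point q v) v) -H.
Qed.

End Monodromy.

(** * From the disc to the plane *)

Lemma within_cvg (S T : topologicalType) (U : Type) (F : set_system U)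
    {FF : Filter F} (A : set S) (f : S -> T) (h : U -> S) (x : S) :
  {within A, continuous f} -> A x -> (\forall u \near F, A (h u)) ->
  h @ F --> x -> f (h u) @[u --> F] --> f x.
Proof.
move=> /subspace_continuousP cf Ax AF hx.
move=> B /(cf _ Ax) nB; have /= FB := hx _ nB.
by apply: filterS2 AF FB => u Au; apply.
Qed.

Lemma ptws_cvg (R : realType) (V : choiceType) (U : Type) (F : set_system U)
    {FF : Filter F} (h : U -> {ptws V -> R}) (x : {ptws V -> R}) :
  (forall v, h u v @[u --> F] --> x v) -> h @ F --> x.
Proof.
move=> H; apply/cvg_sup => i; apply/cvg_image.
  by rewrite eqEsubset; split=> v // _; exists (cst v).
move=> W nW; have := H i W nW => HW.
exists [set g | W (g i)]; first exact: HW.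
by rewrite eqEsubset; split => [j [? + <-//]|j Wj]; exists (fun _ => j).
Qed.

Lemma ptws_cvg_at (R : realType) (V : choiceType) (U : Type) (F : set_system U)
    {FF : Filter F} (h : U -> {ptws V -> R}) (x : {ptws V -> R}) (v : V) :
  h @ F --> x -> h u v @[u --> F] --> x v.
Proof.
move=> H; apply: (@continuous_cvg _ _ _ _ _ h (fun g : {ptws V -> R} => g v)) => //.
exact: (@proj_continuous V (fun=> R) v x).
Qed.

Lemma near_box (R : realType) (z : R * R) (P : R * R -> Prop) :
  (\forall z' \near z, P z') -> exists2 d, 0 < d &
    forall z', `|z'.1 - z.1| < d -> `|z'.2 - z.2| < d -> P z'.
Proof.
move=> /nbhs_ballP [d /= d0 Hd]; exists d => // z' z1 z2.
by apply: Hd; split; rewrite -ball_normE /= distrC.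
Qed.

Lemma cvg_coord (R : realType) (U : Type) (F : set_system U) {FF : Filter F}
    (h : U -> R * R) (x : R * R) : h @ F --> x ->
  (h u).1 @[u --> F] --> x.1 /\ (h u).2 @[u --> F] --> x.2.
Proof.
move=> H; split.
  by apply: (cvg_comp _ fst H); apply: cvg_fst.
by apply: (cvg_comp _ snd H); apply: cvg_snd.
Qed.

Section DiscPlane.
Context (R : realType).

Definition to_disc (z : R * R) : R * R :=
  let r := (Num.sqrt (1 + z.1 ^+ 2 + z.2 ^+ 2))^-1 in (z.1 * r, z.2 * r).
Definition of_disc (z : R * R) : R * R :=
  let r := (Num.sqrt (1 - z.1 ^+ 2 - z.2 ^+ 2))^-1 in (z.1 * r, z.2 * r).

Lemma to_disc_in z : unit_disc (to_disc z).
Proof.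
rewrite /unit_disc /to_disc /= !exprMn -mulrDl exprVn sqr_sqrtr; last first.
  by have := sqr_ge0 z.1; have := sqr_ge0 z.2; lra.
have := sqr_ge0 z.1; have := sqr_ge0 z.2 => h1 h2.
by rewrite ltr_pdivrMr; lra.
Qed.

Lemma to_discK z : of_disc (to_disc z) = z.
Proof.
rewrite /of_disc /to_disc /=.
set D := 1 + z.1 ^+ 2 + z.2 ^+ 2.
have D0 : 0 < D by rewrite /D; have := sqr_ge0 z.1; have := sqr_ge0 z.2; lra.
have s0 : Num.sqrt D != 0 by rewrite gt_eqF // sqrtr_gt0.
have -> : 1 - (z.1 * (Num.sqrt D)^-1) ^+ 2 - (z.2 * (Num.sqrt D)^-1) ^+ 2 = D^-1.
  rewrite !exprMn exprVn sqr_sqrtr ?ltW // -addrA -opprD -mulrDl.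
  have -> : z.1 ^+ 2 + z.2 ^+ 2 = D - 1 by rewrite /D; ring.
  by field; apply: lt0r_neq0.
by rewrite sqrtrV ?ltW // invrK -!mulrA mulVf // !mulr1 -surjective_pairing.
Qed.

Lemma of_discK z : unit_disc z -> to_disc (of_disc z) = z.
Proof.
rewrite /unit_disc /of_disc /to_disc /= => z1.
set D := 1 - z.1 ^+ 2 - z.2 ^+ 2.
have D0 : 0 < D by rewrite /D; lra.
have s0 : Num.sqrt D != 0 by rewrite gt_eqF // sqrtr_gt0.
have -> : 1 + (z.1 * (Num.sqrt D)^-1) ^+ 2 + (z.2 * (Num.sqrt D)^-1) ^+ 2 = D^-1.
  rewrite !exprMn exprVn sqr_sqrtr ?ltW // -addrA -mulrDl.
  have -> : z.1 ^+ 2 + z.2 ^+ 2 = 1 - D by rewrite /D; ring.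
  by field; apply: lt0r_neq0.
by rewrite sqrtrV ?ltW // invrK -!mulrA mulVf // !mulr1 -surjective_pairing.
Qed.

Lemma cvg_scaled (U : Type) (F : set_system U) {FF : Filter F} (h : U -> R * R)
    (k : U -> R) (x : R * R) (y : R) : h @ F --> x -> k @ F --> y -> 0 < y ->
  ((h u).1 * (Num.sqrt (k u))^-1, (h u).2 * (Num.sqrt (k u))^-1) @[u --> F] -->
    (x.1 * (Num.sqrt y)^-1, x.2 * (Num.sqrt y)^-1).
Proof.
move=> hx ky y0.
have ks : (Num.sqrt (k u))^-1 @[u --> F] --> (Num.sqrt y)^-1.
  apply: cvgV; first by rewrite gt_eqF // sqrtr_gt0.
  by apply: (@continuous_cvg _ _ _ _ _ k Num.sqrt) => //; apply: sqrt_continuous.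
have [h1 h2] := cvg_coord hx.
exact: (cvg_pair (cvgM h1 ks) (cvgM h2 ks)).
Qed.

Lemma cvg_coord_sqr (U : Type) (F : set_system U) {FF : Filter F} (h : U -> R * R)
    (x : R * R) : h @ F --> x ->
  (h u).1 ^+ 2 @[u --> F] --> x.1 ^+ 2 /\ (h u).2 ^+ 2 @[u --> F] --> x.2 ^+ 2.
Proof.
move=> /cvg_coord [h1 h2].
by split; rewrite expr2; under eq_fun do rewrite expr2; apply: cvgM.
Qed.

Lemma cvg_to_disc (U : Type) (F : set_system U) {FF : Filter F} (h : U -> R * R)
    (x : R * R) : h @ F --> x -> to_disc (h u) @[u --> F] --> to_disc x.
Proof.
move=> hx; have [h1 h2] := cvg_coord_sqr hx; apply: cvg_scaled => //.
  by apply: cvgD => //; apply: cvgD => //; apply: cvg_cst.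
by have := sqr_ge0 x.1; have := sqr_ge0 x.2; lra.
Qed.

Lemma cvg_of_disc (U : Type) (F : set_system U) {FF : Filter F} (h : U -> R * R)
    (x : R * R) : unit_disc x ->
  h @ F --> x -> of_disc (h u) @[u --> F] --> of_disc x.
Proof.
move=> x1 hx; have [h1 h2] := cvg_coord_sqr hx; apply: cvg_scaled => //.
  by apply: cvgB => //; apply: cvgB => //; apply: cvg_cst.
by rewrite /unit_disc /= in x1; lra.
Qed.

End DiscPlane.

(** Compose the two homeomorphisms with the radial one from the unit disc to the
    plane. *)
Lemma plane_chart_ex (R : realType) (V : choiceType) (K : set {fset V}) :
  triangulation_of_open_disc R K -> exists p q, @plane_chart R V K p q.
Proof.
move=> [[sc _ _ _ _] [D [[oD [f1 [g1 [[f1s f1c [g1s g1c]] [f1K g1K]]]]]]]].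
move=> [f2 [g2 [[f2s f2c [g2s g2c]] [f2K g2K]]]].
pose p z := g2 (g1 (to_disc z)).
pose q x := of_disc (f1 (f2 x)).
have din z : D (g1 (to_disc z)) by apply: g1s; apply: to_disc_in.
have pin z : realization K (p z) by apply: g2s.
have pc z : p z' @[z' --> z] --> p z.
  apply: (within_cvg g2c) => //; first by near=> z'.
  apply: (within_cvg g1c); first exact: to_disc_in.
    by near=> z'; apply: to_disc_in.
  by apply: cvg_to_disc.
exists p, q; split => //.
- move=> z v zv; apply: near_box.
  exact: cvgr_gt (ptws_cvg_at (v := v) (pc z)) _ zv.
- by move=> z; rewrite /q /p g2K // g1K ?to_discK //; apply: to_disc_in.
- by move=> x xr; rewrite /q /p of_discK ?f1K ?f2K //; [apply: f2s | apply/f1s/f2s].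
move=> u v Kuv t t01 e e0.
have inr t' : 0 <= t' <= 1 -> realization K (edge_point u v t').
  exact: realization_edge.
pose F := within [set s : R | 0 <= s <= 1] (nbhs t).
have qc : q (edge_point u v t') @[t' --> F] --> q (edge_point u v t).
  apply: cvg_of_disc; first by apply/f1s/f2s/inr.
  have nearF : \forall t' \near F, 0 <= t' <= 1 by apply: withinT.
  apply: (within_cvg f1c); first by apply/f2s/inr.
    by near=> t'; apply/f2s/inr; near: t'.
  apply: (within_cvg f2c); first exact: inr.
    by near=> t'; apply/inr; near: t'.
  apply: ptws_cvg => w; rewrite /edge_point.
  have tt : t' @[t' --> F] --> t by apply: cvg_within.
  apply: cvgD; apply: cvgM; try exact: cvg_cst; last exact: tt.
  by apply: cvgB; [exact: cvg_cst | exact: tt].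
have [E1 E2] : (\forall t' \near F, `|(q (edge_point u v t')).1 - (q (edge_point u v t)).1| < e) /\
   (\forall t' \near F, `|(q (edge_point u v t')).2 - (q (edge_point u v t)).2| < e).
  by have [/cvgrPdistC_lt/(_ _ e0) ? /cvgrPdistC_lt/(_ _ e0) ?] := cvg_coord qc.
have /nbhs_ballP [d /= d0 Hd] : \forall t' \near t, 0 <= t' <= 1 ->
    `|(q (edge_point u v t')).1 - (q (edge_point u v t)).1| < e /\
    `|(q (edge_point u v t')).2 - (q (edge_point u v t)).2| < e.
  by apply: filterS2 E1 E2.
exists d => // t' t'01 tt'; apply: Hd => //.
by rewrite -ball_normE /= distrC.
Unshelve. all: end_near. Qed.

(** * Combinatorics of a triangulated disc *)

Definition triangle (V : choiceType) (K : set {fset V}) (a b c : V) : Prop :=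
  [/\ a != b, b != c, a != c & K [fset a; b; c]%fset].

(** The combinatorial content of the hypothesis: every edge lies in exactly two
    triangles, and the 1-skeleton and the links of the vertices are connected.
    The two connectedness properties are stated as induction principles. *)
Record surface (V : choiceType) (K : set {fset V}) : Prop := Surface {
  surf_sub : forall s t, K s -> t != fset0 -> (t `<=` s)%fset -> K t;
  surf_nbrs : forall v u, u \in nbrs K v <-> u != v /\ K [fset v; u]%fset;
  surf_edge : forall a b c, triangle K a b c -> b \in nbrs K a;
  surf_apexes : forall a b, b \in nbrs K a -> exists c d,
    [/\ c != d, triangle K a b c, triangle K a b d
      & forall e, triangle K a b e -> e = c \/ e = d];
  surf_connected : forall (A : V -> Prop) o, A o ->
    (forall u v, A u -> v \in nbrs K u -> A v) -> forall v, A v;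
  surf_link : forall v (A : V -> Prop) a, A a -> a \in nbrs K v ->
    (forall b c, A b -> triangle K v b c -> A c) ->
    forall b, b \in nbrs K v -> A b;
  surf_nbrs_ex : forall v, exists u, u \in nbrs K v }.

Section Triangles.
Context (V : choiceType) (K : set {fset V}).

Lemma triangle_rot a b c : triangle K a b c -> triangle K b c a.
Proof.
move=> [ab bc ac Kabc]; split=> //; rewrite 1?eq_sym //.
by rewrite fsetUC fsetUA.
Qed.

Lemma triangle_swap a b c : triangle K a b c -> triangle K b a c.
Proof.
move=> [ab bc ac Kabc]; split=> //; first by rewrite eq_sym.
by rewrite [[fset b; a]%fset]fsetUC.
Qed.

Lemma triangle_swapr a b c : triangle K a b c -> triangle K a c b.
Proof. by move/triangle_swap/triangle_rot. Qed.

Lemma card_triangle a b c : triangle K a b c -> #|` [fset a; b; c]%fset| = 3%N.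
Proof.
move=> [ab bc ac _].
by rewrite fsetUC cardfsU1 !inE eq_sym (negPf ac) eq_sym (negPf bc) cardfs2 ab.
Qed.

Lemma nbrs_sym (hS : surface K) u v : (u \in nbrs K v) = (v \in nbrs K u).
Proof.
by apply/idP/idP => /(surf_nbrs hS) [uv Kuv]; apply/(surf_nbrs hS);
  rewrite eq_sym fsetUC.
Qed.

End Triangles.

Lemma triangulation_surface (R : realType) (V : choiceType) (K : set {fset V}) :
  triangulation_of_open_disc R K -> surface K.
Proof.
move=> hK; have [p [q hp]] := plane_chart_ex hK.
have [[sc d2 infV lf wb] _] := hK.
have [Ksub Kne Kv] := sc.
have finN v : finite_set [set u | adj K v u].
  apply: (@sub_finite_set _ _ (\bigcup_(s in [set s | K s /\ v \in s]) [set` s])).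
    move=> u [_ Kvu]; exists [fset v; u]%fset; rewrite /= !inE eqxx ?orbT //.
  by apply: bigcup_finite => // s _; apply: finite_fset.
have nbrsP v u : u \in nbrs K v <-> u != v /\ K [fset v; u]%fset.
  rewrite /nbrs in_fset_set // inE /adj /=; split=> -[vu Kvu]; split=> //.
    by apply/eqP => uv; apply: vu.
  by move=> vu'; move/eqP: vu; rewrite vu'.
have conn (A : V -> Prop) o : A o ->
    (forall u v, A u -> v \in nbrs K u -> A v) -> forall v, A v.
  move=> Ao H; apply: (skeleton_connected hp Ao) => u v Au Kuv.
  have [->//|uv] := eqVneq v u; apply: (H u) => //.
  by apply/nbrsP.
have edge a b c : triangle K a b c -> b \in nbrs K a.
  move=> [ab bc ac Kabc]; apply/nbrsP; rewrite eq_sym; split=> //.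
  apply: Kne Kabc _ _; first by apply/fset0Pn; exists a; rewrite !inE eqxx.
  by apply/fsubsetP => x; rewrite !inE => ->.
split=> //.
- move=> a b /nbrsP [ba Kab].
  have cab : #|` [fset a; b]%fset| = 2%N by rewrite cardfs2 eq_sym ba.
  have := wb _ Kab cab; set T := [set t | _] => HT.
  have finT : finite_set T by apply/finite_setP; exists 2%N.
  have [X TX cX] : exists2 X : {fset {fset V}}, T = [set` X] & #|` X| = 2%N.
    by exists (fset_set T); rewrite ?fset_setK //; apply: card_fset_set.
  have apex t : T t -> exists c, t = [fset a; b; c]%fset /\ triangle K a b c.
    move=> [Kt ct sub].
    have : #|` (t `\` [fset a; b])%fset| == 1%N by rewrite cardfsDS // cab ct.
    move=> /cardfs1P [c tc]; exists c.
    have ct' : c \in (t `\` [fset a; b])%fset by rewrite tc inE.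
    move: ct'; rewrite !inE negb_or => /andP[/andP[ca cb] ct'].
    have Et : t = [fset a; b; c]%fset.
      apply/fsetP => x; rewrite in_fsetU -tc in_fsetD.
      by case: (boolP (x \in [fset a; b]%fset)) => // /(fsubsetP sub).
    by split=> //; split; rewrite -?Et // eq_sym.
  have /fset0Pn [t1 t1X] : X != fset0 by rewrite -cardfs_gt0 cX.
  have : #|` (X `\ t1)%fset| == 1%N.
    by have := cardfsD1 t1 X; rewrite t1X cX /= add1n => -[<-].
  move=> /cardfs1P [t2 Xt2].
  have : t2 \in (X `\ t1)%fset by rewrite Xt2 inE.
  rewrite !inE => /andP[t21 t2X].
  have TXi t : t \in X <-> T t by rewrite TX.
  have [c [E1 T1]] := apex t1 (iffLR (TXi _) t1X).
  have [d [E2 T2]] := apex t2 (iffLR (TXi _) t2X).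
  exists c, d; split=> //.
    by apply: contraNneq t21 => cd; rewrite E1 E2 cd.
  move=> e Te.
  have : [fset a; b; e]%fset \in X.
    apply/TXi; split; first by case: Te.
      exact: card_triangle Te.
    by apply/fsubsetP => x; rewrite !inE => ->.
  have ee : e \notin [fset a; b]%fset.
    by case: Te => _ be ae _; rewrite !inE negb_or eq_sym ae eq_sym.
  move=> eX; have [E|ne] := eqVneq [fset a; b; e]%fset t1.
    left; have : e \in t1 by rewrite -E !inE eqxx ?orbT.
    by rewrite E1 inE (negPf ee) /= inE => /eqP.
  have : [fset a; b; e]%fset \in (X `\ t1)%fset by rewrite in_fsetD1 ne.
  rewrite Xt2 inE => /eqP E; right; have : e \in t2 by rewrite -E !inE eqxx ?orbT.
  by rewrite E2 inE (negPf ee) /= inE => /eqP.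
- move=> v A a Aa /nbrsP [av Kva] H b /nbrsP [bv Kvb].
  apply: (link_connected hp Aa av Kva _ bv Kvb) => x y Ax xv yv Kvxy.
  have [<-//|xy] := eqVneq x y; apply: (H x) => //.
  by split=> //; rewrite eq_sym.
move=> v; apply: contrapT => nu.
apply: infV; apply: (@sub_finite_set _ _ [set v]); last exact: finite_set1.
move=> u _; apply: (conn (fun u => u = v) v) => // x y -> yv.
by case: nu; exists y.
Qed.

(** * Multivalued angles around a vertex *)

(** The structure needed on the values [exp (i h)] of a multivalued angle:
    addition of a real angle, and change of sign. *)
Record rotation_action (R : realType) (Z : Type) (rot : R -> Z -> Z)
    (cj : Z -> Z) : Prop := RotationAction {
  rot_zero : forall z, rot 0 z = z;
  rot_add : forall s t z, rot (s + t) z = rot s (rot t z);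
  cjK : involutive cj;
  cj_rot : forall t z, cj (rot t z) = rot (- t) (cj z) }.

(** In the application [X] is the set of pairs [(b, c)] such that [v b c] is a
    triangle, [r] exchanges [b] and [c], and [P (b, c) = (d, b)] where [d] is the
    other apex of the edge [v b]: [P] turns around [v] by one triangle. No
    orientation is chosen beforehand: the link, run through in the two possible
    directions, gives the two orbits of [P], and [r] exchanges them. *)
Section OrbitSection.
Context (R : realType) (Z : Type) (rot : R -> Z -> Z) (cj : Z -> Z).
Context (hrot : rotation_action rot cj).
Context (X : finType) (P r : X -> X) (th : X -> R).
Context (rK : involutive r) (PrP : forall x, P (r (P x)) = r x).
Context (r_neq : forall x, r x <> x) (r_neqP : forall x, r x <> P x).

Lemma step_inj : injective P.
Proof. by move=> x y E; apply: (can_inj rK); rewrite -PrP E PrP. Qed.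

(** A palindromic orbit would have a middle, and there reversal would fix a pair
    or act as one step. *)
Lemma reverse_notin_orbit x : ~~ fconnect P x (r x).
Proof.
apply/negP => /iter_findex; set k := findex _ _ _ => Ek.
have H j : (j <= k)%N -> r (iter j P x) = iter (k - j) P x.
  elim: j => [|j IH] jk; first by rewrite subn0 Ek.
  apply: step_inj; rewrite [iter j.+1 P x]/= PrP IH 1?ltnW //.
  by rewrite -iterS -subSn // subSS.
have [m [E|E]] : exists m, k = (m + m)%N \/ k = (m + m).+1.
  exists k./2; have := odd_double_half k; rewrite -addnn.
  by case: (odd k) => /= E; [right|left]; rewrite -[LHS]E.
  - by apply: (@r_neq (iter m P x)); rewrite H E ?leq_addl // addnK.
by apply: (@r_neqP (iter m P x)); rewrite H E ?subSn ?addnK // -?addnS leq_addr.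
Qed.

Context (conn : forall x y, fconnect P x y || fconnect P x (r y)).
Context (thr : forall x, th (r (P x)) = th x).
Context (cycle : forall x z, rot (\sum_(y <- orbit P x) th y) z = z).

(** Turn around one orbit of [P] and accumulate the angles, which is consistent
    as the total angle acts trivially; conjugate on the other orbit. *)
Lemma orbit_section x0 z0 : exists y : X -> Z, [/\ y x0 = z0,
  forall x, y (P x) = rot (th x) (y x) & forall x, y (r x) = cj (y x)].
Proof.
pose S n : R := \sum_(i < n) th (iter i P x0).
pose y0 x := rot (S (findex P x0 x)) z0.
pose y x := if fconnect P x0 x then y0 x else cj (y0 (r x)).
have Pconn x : fconnect P x0 (P x) = fconnect P x0 x.
  rewrite [RHS](same_connect_r (fconnect_sym step_inj) (y := P x)) //.
  exact: fconnect1.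
have excl x : fconnect P x0 (r x) = ~~ fconnect P x0 x.
  have := conn x0 x; case: (boolP (fconnect P x0 x)) => //= x0x _.
  apply/negP => x0rx; have := reverse_notin_orbit x; rewrite -(same_connect (fconnect_sym step_inj) x0x) x0rx.
  by [].
have y0P x : fconnect P x0 x -> y0 (P x) = rot (th x) (y0 x).
  move=> x0x; rewrite /y0; have := iter_findex x0x; have := findex_max x0x.
  set n := findex P x0 x => nlt En.
  have SS : S n.+1 = th x + S n by rewrite /S big_ord_recr /= En addrC.
  have -> : P x = iter n.+1 P x0 by rewrite /= En.
  have [lt|ge] := ltnP n.+1 (order P x0).
    by rewrite findex_iter // SS (rot_add hrot).
  have En1 : n.+1 = order P x0 by apply/eqP; rewrite eqn_leq nlt ge.
  rewrite En1 (iter_order step_inj) findex0 {1}/S big_ord0 (rot_zero hrot).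
  rewrite -(rot_add hrot) -SS En1 -[LHS](cycle x0) /orbit; congr rot.
  rewrite /S (big_nth x0) size_traject big_mkord; apply: eq_bigr => i _.
  by rewrite nth_traject.
exists y; split.
- by rewrite /y connect0 /y0 findex0 /S big_ord0 (rot_zero hrot).
- move=> x; rewrite /y Pconn; case: ifP => x0x; first exact: y0P.
  rewrite -[in RHS]PrP y0P ?(cj_rot hrot) ?thr -?(rot_add hrot) ?subrr ?(rot_zero hrot) //.
    by rewrite add0r.
  by rewrite excl Pconn x0x.
move=> x; rewrite /y excl rK; case: (fconnect P x0 x) => //=.
by rewrite (cjK hrot).
Qed.

End OrbitSection.

Section SurfaceSections.
Context (R : realType) (V : choiceType) (K : set {fset V}) (hS : surface K).
Context (Z : Type) (rot : R -> Z -> Z) (cj : Z -> Z).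
Context (hrot : rotation_action rot cj).
Context (th : V -> V -> R).

Lemma apex_other : exists oth : V -> V -> V -> V, forall a b c,
  triangle K a b c -> [/\ oth a b c != c, triangle K a b (oth a b c)
    & forall e, triangle K a b e -> e = c \/ e = oth a b c].
Proof.
have ex (abc : V * V * V) : exists d, triangle K abc.1.1 abc.1.2 abc.2 ->
   [/\ d != abc.2, triangle K abc.1.1 abc.1.2 d
    & forall e, triangle K abc.1.1 abc.1.2 e -> e = abc.2 \/ e = d].
  case: abc => [[a b] c] /=; have [T|nT] := pselect (triangle K a b c); last by exists c.
  have [x [y [xy Tx Ty H]]] := surf_apexes hS (surf_edge hS T).
  have [E|E] := H c T.
    by exists y; rewrite E eq_sym => _; split=> //.
  by exists x; rewrite E => _; split=> // e /H [|]; [right|left].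
by have [f Hf] := choice ex; exists (fun a b c => f (a, b, c)) => a b c /(Hf (a, b, c)).
Qed.

(** Lifts, over the triangles around [v], of the multivalued function whose
    jump across the edge [v b] is the rotation by [th v b]. *)
Definition local_sec v (y : V -> V -> Z) : Prop :=
  (forall b c, triangle K v b c -> y c b = cj (y b c)) /\
  (forall b c d, triangle K v b c -> triangle K v b d -> c != d ->
     y d b = rot (th v b) (y b c)).

Lemma local_sec_unique v y y' b c : local_sec v y -> local_sec v y' ->
  triangle K v b c -> y b c = y' b c ->
  forall b' c', triangle K v b' c' -> y b' c' = y' b' c'.
Proof.
move=> [h1 h2] [h1' h2'] T E b' c' T'.
have [oth Hoth] := apex_other.
have spread x w : triangle K v x w -> y x w = y' x w ->
    forall e, triangle K v x e -> y x e = y' x e.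
  move=> Tx Ex e; have [ow Tw Hw] := Hoth _ _ _ Tx => Te.
  have [->//|ew] := eqVneq e w.
  have Ee : y e x = y' e x by rewrite (h2 x w e) // 1?(h2' x w e) ?Ex // eq_sym.
  have Te' := triangle_swapr Te.
  by rewrite (h1 e x) // (h1' e x) // Ee.
have b'v := surf_edge hS T'; move: c' T'; move: b' b'v.
apply: (surf_link hS (A := fun b' => forall c', triangle K v b' c' -> y b' c' = y' b' c')
  (a := b)); first by move=> c' Tc'; apply: (spread b c).
  exact: surf_edge T.
move=> x w Ax Tx e Te; apply: (spread w x) => //; first exact: triangle_swapr.
by rewrite h1 // h1' // Ax.
Qed.

Hypothesis th_cycle : forall v z, rot (\sum_(u <- nbrs K v) th v u) z = z.

(** The first vertices of the pairs of one orbit run once through the neighbours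
    of [v], by connectedness of the link; so the total angle around the orbit is
    the divergence of [th] at [v]. *)
Lemma local_sec_ex v b c z : triangle K v b c ->
  exists2 y, local_sec v y & y b c = z.
Proof.
move=> Tbc; have [oth Hoth] := apex_other.
pose flags : {fset V * V} :=
  [fset x in (nbrs K v `*` nbrs K v)%fset | `[< triangle K v x.1 x.2 >]]%fset.
have flagP (x : V * V) : (x \in flags) <-> triangle K v x.1 x.2.
  rewrite !inE /=; split; first by move=> /andP[_ /asboolP].
  move=> T; rewrite (surf_edge hS T) (surf_edge hS (triangle_swapr T)) /=.
  exact/asboolP.
pose X : finType := flags.
pose P (x : X) : X := insubd x (oth v (val x).1 (val x).2, (val x).1).
pose r (x : X) : X := insubd x ((val x).2, (val x).1).
have TX (x : X) : triangle K v (val x).1 (val x).2 by apply/flagP/valP.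
have vP x : val (P x) = (oth v (val x).1 (val x).2, (val x).1).
  rewrite /P insubdK //; apply/flagP => /=; have [_ T _] := Hoth _ _ _ (TX x).
  exact: triangle_swapr.
have vr x : val (r x) = ((val x).2, (val x).1).
  by rewrite /r insubdK //; apply/flagP => /=; exact: triangle_swapr (TX x).
have rK : involutive r.
  by move=> x; apply: val_inj; rewrite !vr -surjective_pairing.
have othK (x : X) : oth v (val x).1 (oth v (val x).1 (val x).2) = (val x).2.
  have [n1 T1 H1] := Hoth _ _ _ (TX x); have [n2 T2 H2] := Hoth _ _ _ T1.
  by have [//|E] := H1 _ T2; rewrite E eqxx in n2.
have PrP x : P (r (P x)) = r x.
  by apply: val_inj; rewrite !(vP, vr) /= othK.
have rn x : r x <> x.
  move=> /(congr1 val); rewrite vr => E; have [_ + _ _] := TX x.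
  by rewrite -{1}E eqxx.
have rnP x : r x <> P x.
  move=> /(congr1 val); rewrite vr vP => -[E]; have [+ _ _] := Hoth _ _ _ (TX x).
  by rewrite -E eqxx.
have Pinj := step_inj rK PrP.
have Psym := fconnect_sym Pinj.
have same1 (x x' : X) : (val x').1 = (val x).1 -> x' = x \/ x' = r (P x).
  move=> E; have [_ _ H] := Hoth _ _ _ (TX x).
  have := TX x'; rewrite E => /H [E'|E']; [left|right]; apply: val_inj.
    by rewrite [val x']surjective_pairing E E' -surjective_pairing.
  by rewrite [val x']surjective_pairing E E' vr vP.
have nr x x' : fconnect P x x' -> ~~ fconnect P x (r (P x')).
  move=> xx'; rewrite (same_connect Psym (y := P x')); first exact: reverse_notin_orbit.
  by apply: connect_trans xx' _; apply: fconnect1.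
have surj x w : w \in nbrs K v -> exists2 x', fconnect P x x' & (val x').1 = w.
  move: w; apply: (surf_link hS (A := fun w => exists2 x', fconnect P x x' & (val x').1 = w)
    (a := (val x).1)); first by exists x.
    exact: surf_edge (TX x).
  move=> e f [x' xx' E] T; have [_ _ H] := Hoth _ _ _ (TX x').
  move: T; rewrite -E => /H[->|->].
    have xf : fconnect P x (finv P x').
      by apply: connect_trans xx' _; rewrite Psym -{2}(f_finv Pinj x'); apply: fconnect1.
    exists (finv P x') => //.
    by rewrite -{2}(f_finv Pinj x') vP.
  exists (P x'); last by rewrite vP.
  by apply: connect_trans xx' _; apply: fconnect1.
have conn x y : fconnect P x y || fconnect P x (r y).
  have [x' xx' E] := surj x (val y).1 (surf_edge hS (TX y)).
  have [->|->] := same1 x' y (esym E); first by rewrite xx'.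
  rewrite rK orbC (connect_trans xx') //; exact: fconnect1.
pose t (x : X) := th v (val x).1.
have thr x : t (r (P x)) = t x by rewrite /t vr vP.
have cyc x z' : rot (\sum_(y <- orbit P x) t y) z' = z'.
  rewrite -[RHS](th_cycle v); congr rot.
  rewrite /t -(big_map (fun y : X => (val y).1) xpredT (th v)).
  apply: perm_big; apply: uniq_perm; last 2 first.
  - exact: fset_uniq.
  - move=> w; apply/mapP/idP; last first.
      by move=> /(surj x) [x' xx' <-]; exists x' => //; rewrite -fconnect_orbit.
    by move=> [x' _ ->]; apply: surf_edge (TX x').
  rewrite map_inj_in_uniq; first exact: orbit_uniq.
  move=> x1 x2; rewrite -!fconnect_orbit => h1 h2 /same1 [//|E].
  by have := nr _ _ h2; rewrite -E h1.
have bcF : (b, c) \in flags by apply/flagP.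
have [y [y0 yP yr]] := orbit_section hrot rK PrP rn rnP conn thr cyc
  (FSetSub bcF : X) z.
exists (fun x1 x2 => if insub (x1, x2) is Some x then y (x : X) else z); last first.
  by rewrite insubT.
have yE x1 x2 (h : (x1, x2) \in flags) :
    (if insub (x1, x2) is Some x then y (x : X) else z) = y (FSetSub h).
  by rewrite insubT; congr y; apply: val_inj.
split.
- move=> x1 x2 T; have h : (x1, x2) \in flags by apply/flagP.
  have h' : (x2, x1) \in flags by apply/flagP/triangle_swapr.
  by rewrite !yE -yr; congr y; apply: val_inj; rewrite vr.
move=> x1 x2 d T Td x2d; have h : (x1, x2) \in flags by apply/flagP.
have h' : (d, x1) \in flags by apply/flagP/triangle_swapr.
have -> : th v x1 = t (FSetSub h) by [].
rewrite !yE -yP; congr y; apply: val_inj; rewrite vP /=.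
have [_ _ H] := Hoth _ _ _ T.
by have [E|->//] := H _ Td; rewrite E eqxx in x2d.
Qed.
End SurfaceSections.

(** * Multivalued angles on a simply connected complex *)

Definition simply_connected (V : choiceType) (K : set {fset V}) : Prop :=
  forall (T : Type) (Sec : V -> T -> Prop) (rho : V -> V -> T -> T),
    local_system K Sec rho -> forall o s0, Sec o s0 ->
    exists b : V -> T, (forall v, Sec v (b v)) /\
      (forall u v, K [fset u; v]%fset -> b v = rho u v (b u)).

Lemma triangulation_simply_connected (R : realType) (V : choiceType)
    (K : set {fset V}) : triangulation_of_open_disc R K -> simply_connected K.
Proof.
move=> hK T Sec rho hrho o s0 Ss0.
have [p [q hp]] := plane_chart_ex hK.
by have [b _ H] := trivial_monodromy hp hrho Ss0; exists b.
Qed.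

Section MultivaluedPrimitive.
Context (R : realType) (V : choiceType) (K : set {fset V}) (hS : surface K).
Context (hsc : simply_connected K).
Context (Z : Type) (rot : R -> Z -> Z) (cj : Z -> Z).
Context (hrot : rotation_action rot cj).
Context (th : V -> V -> R).
Hypothesis th_anti : forall u v, th u v = - th v u.
Hypothesis th_cycle : forall v z, rot (\sum_(u <- nbrs K v) th v u) z = z.

(** [y u v] and [y' v u] are values at the same triangles, read with opposite
    orientations. *)
Definition agree u v (y y' : V -> V -> Z) : Prop :=
  forall c, triangle K u v c -> y' u c = cj (y v c).

Lemma agree_sym u v y y' : agree u v y y' -> agree v u y' y.
Proof. by move=> H c /triangle_swap /H ->; rewrite (cjK hrot). Qed.

(** Agreement on one side of an edge implies agreement on the other side, where
    both values are rotated by opposite angles. *)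
Lemma agree_one u v y y' c : local_sec K rot cj th u y ->
  local_sec K rot cj th v y' -> triangle K u v c -> y' u c = cj (y v c) ->
  agree u v y y'.
Proof.
move=> [h1 h2] [h1' h2'] Tc E d Td; have [->//|dc] := eqVneq d c.
have T'c := triangle_swap Tc; have T'd := triangle_swap Td.
rewrite eq_sym in dc.
rewrite -[LHS](cjK hrot) -(h1' u d) // (h2' u c d) // E th_anti -(cj_rot hrot).
by rewrite -(h2 v c d) // (h1 v d) // (cjK hrot).
Qed.

Lemma agree_trans u v w y y' y'' : triangle K u v w -> local_sec K rot cj th u y ->
  local_sec K rot cj th v y' -> local_sec K rot cj th w y'' ->
  agree u v y y' -> agree v w y' y'' -> agree u w y y''.
Proof.
move=> T hy hy' hy'' a1 a2.
have T2 : triangle K v w u by apply: triangle_rot.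
have T3 : triangle K w u v by apply: triangle_rot.
apply: (@agree_one u w y y'' v) => //; first exact: triangle_swapr.
rewrite hy''.1; last exact: triangle_swapr.
rewrite (a2 u) // hy'.1; last exact: triangle_swap.
rewrite (a1 w) // hy.1; last exact: triangle_swapr.
by rewrite !(cjK hrot).
Qed.

(** The conditions met by the lifts of [exp (i h)], for a function [h] on the
    oriented triangles that changes sign with the orientation and jumps by
    [th a b] across the edge [ab]. *)
Definition primitive_mod (z : V -> V -> V -> Z) : Prop :=
  (forall a b c, triangle K a b c -> z a c b = cj (z a b c) /\ z b a c = cj (z a b c)) /\
  (forall a b c d, triangle K a b c -> triangle K a b d -> c != d ->
     z a d b = rot (th a b) (z a b c)).

(** A flow [th] whose divergence at each vertex is a full number of turns is the
    jump of a multivalued angle on the triangles. The lifts around the vertices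
    form a local system, and the disc is simply connected. *)
Lemma primitive_mod_ex (o : V) (dz : Z) : exists z, primitive_mod z.
Proof.
pose Sec v y := local_sec K rot cj th v y /\
  forall b c, ~ triangle K v b c -> y b c = dz.
have sec_ex v b c z : triangle K v b c -> exists2 y, Sec v y & y b c = z.
  move=> T; have [y [h1 h2] E] := local_sec_ex hS hrot th_cycle z T.
  exists (fun b c => if asbool (triangle K v b c) then y b c else dz); last first.
    by rewrite asboolT.
  split; last by move=> b' c' nT; rewrite asboolF.
  split=> [b' c' T'|b' c' d T' Td cd].
    by rewrite (asboolT T') (asboolT (triangle_swapr T')) h1.
  by rewrite (asboolT T') (asboolT (triangle_swapr Td)) (h2 b' c' d).
have sec_eq v y y' b c : Sec v y -> Sec v y' -> triangle K v b c ->
    y b c = y' b c -> y = y'.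
  move=> [hy y0] [hy' y0'] T E; apply/funext => b'; apply/funext => c'.
  have [T'|nT] := pselect (triangle K v b' c'); last by rewrite y0 ?y0'.
  exact: (local_sec_unique hS hy hy' T E).
have edge_tri u v : u != v -> K [fset u; v]%fset -> exists c, triangle K u v c.
  move=> uv Kuv; have vu : v \in nbrs K u by apply/(surf_nbrs hS); rewrite eq_sym.
  by have [c [_ [_ T _ _]]] := surf_apexes hS vu; exists c.
have agree_eq u v y y1 y2 : u != v -> K [fset u; v]%fset -> Sec v y1 -> Sec v y2 ->
    agree u v y y1 -> agree u v y y2 -> y1 = y2.
  move=> uv Kuv s1 s2 a1 a2; have [c T] := edge_tri u v uv Kuv.
  by apply: (sec_eq v y1 y2 u c) => //; [apply: triangle_swap|rewrite a1 // a2].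
have rho_ex (x : V * V * (V -> V -> Z)) : exists y', [/\ x.1.1 = x.1.2 -> y' = x.2
   & x.1.1 != x.1.2 -> K [fset x.1.1; x.1.2]%fset -> Sec x.1.1 x.2 ->
     Sec x.1.2 y' /\ agree x.1.1 x.1.2 x.2 y'].
  case: x => [[u v] y] /=; have [->|uv] := eqVneq u v; first by exists y.
  have [[Kuv sy]|n] := pselect (K [fset u; v]%fset /\ Sec u y); last first.
    by exists y; split=> // _ Kuv sy; case: n.
  have [c T] := edge_tri u v uv Kuv.
  have [y' sy' E] := sec_ex v u c (cj (y v c)) (triangle_swap T).
  exists y'; split=> [uv'|_ _ _]; first by rewrite uv' eqxx in uv.
  by split=> //; apply: (agree_one sy.1 sy'.1 T).
have [f Hf] := choice rho_ex.
pose rho u v y := f (u, v, y).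
have rho_id u y : rho u u y = y by have [/(_ erefl)] := Hf (u, u, y).
have rho_ne u v y : u != v -> K [fset u; v]%fset -> Sec u y ->
    Sec v (rho u v y) /\ agree u v y (rho u v y) by have [_] := Hf (u, v, y).
have hrho : local_system K Sec rho.
  have sec u v s : K [fset u; v]%fset -> Sec u s -> Sec v (rho u v s).
    have [<-|uv] := eqVneq u v; first by rewrite rho_id.
    by move=> Kuv ss; case: (rho_ne u v s uv Kuv ss).
  split=> // u v w s Kuvw ss.
  have [E|uv] := eqVneq u v; first by rewrite -E rho_id.
  have [E|vw] := eqVneq v w; first by rewrite -E rho_id.
  have sub x y : x \in [fset u; v; w]%fset -> y \in [fset u; v; w]%fset ->
      K [fset x; y]%fset.
    move=> hx hy; apply: (surf_sub hS Kuvw); first by apply/fset0Pn; exists x; rewrite !inE eqxx.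
    by apply/fsubsetP => e; rewrite inE => /orP[] /[!inE] /eqP ->; [move: hx|move: hy]; rewrite !inE.
  have Kuv : K [fset u; v]%fset by apply: sub; rewrite !inE eqxx ?orbT.
  have Kvw : K [fset v; w]%fset by apply: sub; rewrite !inE eqxx ?orbT.
  have Kuw : K [fset u; w]%fset by apply: sub; rewrite !inE eqxx ?orbT.
  have [s1 a1] := rho_ne u v s uv Kuv ss.
  have [s2 a2] := rho_ne v w _ vw Kvw s1.
  have [E|uw] := eqVneq u w.
    move: s2 a2; rewrite -E rho_id => s2 a2.
    by apply: (agree_eq v u (rho u v s)) => //; [rewrite eq_sym|rewrite fsetUC|exact: agree_sym].
  have [s3 a3] := rho_ne u w s uw Kuw ss.
  apply: (agree_eq u w s) => //.
  by apply: agree_trans a1 a2 => //; [case: ss|case: s1|case: s2].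
have [u1 hu1] := surf_nbrs_ex hS o.
have [c1 [_ [_ T1 _ _]]] := surf_apexes hS hu1.
have [y0 sy0 _] := sec_ex o u1 c1 dz T1.
have [b [bs bt]] := hsc hrho sy0.
exists b; split=> [a b' c T|a b' c d]; last first.
  by have [[_ H] _] := bs a; apply: H.
have [[h1 _] _] := bs a; split; first exact: h1.
have [ab _] := T; have /(surf_nbrs hS)[_ Kab] := surf_edge hS T => _ _.
rewrite (bt _ _ Kab).
by have [_ ->] := rho_ne a b' (b a) ab Kab (bs a).
Qed.
End MultivaluedPrimitive.

(** * Finite Dirichlet sums *)

Section DirichletSums.
Context (R : realType) (V : choiceType) (N : V -> {fset V}).
Hypothesis Nsym : forall u v, (u \in N v) = (v \in N u).
Implicit Types (B A : {fset V}) (t : V -> V -> R) (f : V -> R).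

(** Each unordered edge of [B] is counted twice. All energies and pairings are
    handled through such finite sums, and a bound on the energy is a bound on
    all of them. *)
Definition edge_sum B t : R := \sum_(x <- B) \sum_(y <- B | y \in N x) t x y.
Definition grad f x y : R := f y - f x.
Definition divergence t x : R := \sum_(y <- N x) t x y.
Definition laplacian f : V -> R := divergence (grad f).
Definition square_bound t (C : R) : Prop :=
  forall B, edge_sum B (fun x y => t x y ^+ 2) <= C.
Definition supported A f : Prop := forall x, x \notin A -> f x = 0.
Definition hull A : {fset V} := (A `|` \bigcup_(x <- A) N x)%fset.

Lemma sub_hull A : (A `<=` hull A)%fset. Proof. exact: fsubsetUl. Qed.

Lemma hull_nbr A x y : x \in A -> y \in N x -> y \in hull A.
Proof.
move=> xA yx; rewrite /hull inE; apply/orP; right.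
by apply/bigfcupP; exists x => //; rewrite xA.
Qed.

Lemma edge_sum_eq B t t' : (forall x y, x \in B -> y \in B -> y \in N x -> t x y = t' x y) ->
  edge_sum B t = edge_sum B t'.
Proof.
move=> H; apply: eq_big_seq => x xB; rewrite big_seq_cond [RHS]big_seq_cond.
by apply: eq_bigr => y /andP[yB yx]; apply: H.
Qed.

Lemma edge_sum_le B t t' : (forall x y, x \in B -> y \in B -> y \in N x -> t x y <= t' x y) ->
  edge_sum B t <= edge_sum B t'.
Proof.
move=> H; rewrite /edge_sum big_seq [leRHS]big_seq; apply: ler_sum => x xB.
rewrite big_seq_cond [leRHS]big_seq_cond; apply: ler_sum => y /andP[yB yx].
exact: H.
Qed.

Lemma edge_sumD B t t' :
  edge_sum B (fun x y => t x y + t' x y) = edge_sum B t + edge_sum B t'.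
Proof.
by rewrite /edge_sum -big_split /=; apply: eq_bigr => x _; rewrite big_split.
Qed.

Lemma edge_sumZ B (c : R) t : edge_sum B (fun x y => c * t x y) = c * edge_sum B t.
Proof.
rewrite /edge_sum mulr_sumr; apply: eq_bigr => x _.
by rewrite mulr_sumr.
Qed.

Lemma edge_sumB B t t' :
  edge_sum B (fun x y => t x y - t' x y) = edge_sum B t - edge_sum B t'.
Proof.
rewrite -[- edge_sum _ _]mulN1r -edge_sumZ -edge_sumD.
by apply: edge_sum_eq => x y *; rewrite mulN1r.
Qed.

Lemma edge_sum_swap B t : edge_sum B t = edge_sum B (fun x y => t y x).
Proof.
rewrite /edge_sum (exchange_big_dep xpredT) //=; apply: eq_bigr => y _.
by apply: eq_bigl => x; rewrite Nsym.
Qed.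

Lemma big_fset_sub (A B : {fset V}) (P : pred V) (F : V -> R) : (A `<=` B)%fset ->
  \sum_(x <- B | P x && (x \in A)) F x = \sum_(x <- A | P x) F x.
Proof.
move=> AB; rewrite -big_filter -[RHS]big_filter; apply: perm_big; apply: uniq_perm.
- by rewrite filter_uniq.
- by rewrite filter_uniq.
move=> x; rewrite !mem_filter -andbA; congr (_ && _).
by case: (boolP (x \in A)) => //= /(fsubsetP AB).
Qed.

Lemma edge_sum_widen A B t : (A `<=` B)%fset ->
  edge_sum A t = edge_sum B (fun x y => if (x \in A) && (y \in A) then t x y else 0).
Proof.
move=> AB; rewrite /edge_sum -(big_fset_sub xpredT _ AB) /= big_mkcond /=.
apply: eq_bigr => x _; case: (x \in A) => /=; last by rewrite big1.
by rewrite -(big_fset_sub _ _ AB) -big_mkcondr.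
Qed.

Lemma edge_sum_mono A B t : (A `<=` B)%fset -> (forall x y, 0 <= t x y) ->
  edge_sum A t <= edge_sum B t.
Proof.
move=> AB t0; rewrite (edge_sum_widen _ AB); apply: edge_sum_le => x y _ _ _.
by case: ifP.
Qed.

(** Used in place of the Cauchy-Schwarz inequality, the weight [c] being chosen
    according to the sizes of the two sums. *)
Lemma edge_sum_amgm B t t' (c : R) : 0 < c ->
  2 * edge_sum B (fun x y => `|t x y| * `|t' x y|) <=
    c * edge_sum B (fun x y => t x y ^+ 2) + c^-1 * edge_sum B (fun x y => t' x y ^+ 2).
Proof.
move=> c0; rewrite -!edge_sumZ -edge_sumD; apply: edge_sum_le => x y _ _ _.
rewrite -(real_normK (num_real (t x y))) -(real_normK (num_real (t' x y))).
set a := `|t x y|; set b := `|t' x y|.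
rewrite -subr_ge0.
have -> : c * a ^+ 2 + c^-1 * b ^+ 2 - 2 * (a * b) = c^-1 * (c * a - b) ^+ 2.
  by field; apply: lt0r_neq0.
by rewrite mulr_ge0 ?sqr_ge0 // invr_ge0 ltW.
Qed.

(** Summation by parts. The sum does not depend on [B] as long as [B] contains
    the support of [f] and its neighbours. *)
Lemma edge_sum_by_parts A B t f : (hull A `<=` B)%fset -> supported A f ->
  (forall x y, t x y = - t y x) ->
  edge_sum B (fun x y => t x y * grad f x y) =
    - 2 * \sum_(x <- A) f x * divergence t x.
Proof.
move=> AB fA ta.
have E : edge_sum B (fun x y => t x y * f x) = \sum_(x <- A) f x * divergence t x.
  rewrite /edge_sum -(big_fset_sub xpredT _ (fsubset_trans (sub_hull A) AB)) /=.
  rewrite [RHS]big_mkcond /=; apply: eq_bigr => x _; case: (boolP (x \in A)) => xA; last first.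
    by rewrite big1 // => y _; rewrite (fA x xA) mulr0.
  rewrite /divergence mulr_sumr -[RHS](@big_fset_sub (N x) B xpredT (fun i => f x * t x i)).
    by apply: eq_bigr => y _; rewrite mulrC.
  by apply/fsubsetP => y yx; apply: (fsubsetP AB); apply: hull_nbr yx.
rewrite -E; under [in LHS]edge_sum_eq => x y do rewrite /grad mulrBr.
rewrite edge_sumB [X in X - _]edge_sum_swap.
rewrite (edge_sum_eq (t' := fun x y => -1 * (t x y * f x))) ?edge_sumZ; first by ring.
by move=> x y _ _ _; rewrite ta; ring.
Qed.

Lemma square_bound_le t C C' : square_bound t C -> C <= C' -> square_bound t C'.
Proof. by move=> H CC B; apply: le_trans (H B) CC. Qed.

Lemma square_bound_mono t t' C : square_bound t C ->
  (forall x y, y \in N x -> `|t' x y| <= `|t x y|) -> square_bound t' C.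
Proof.
move=> H tt B; apply: le_trans (H B); apply: edge_sum_le => x y _ _ yx.
by rewrite -(real_normK (num_real (t x y))) -(real_normK (num_real (t' x y)))
  lerXn2r ?nnegrE ?tt.
Qed.

Lemma square_bound_ge0 t C : square_bound t C -> 0 <= C.
Proof.
by move=> H; apply: le_trans (H fset0); rewrite /edge_sum big_seq_fset0.
Qed.

Lemma square_boundD t t' C C' : square_bound t C -> square_bound t' C' ->
  square_bound (fun x y => t x y + t' x y) (2 * C + 2 * C').
Proof.
move=> H H' B.
apply: (@le_trans _ _ (2 * edge_sum B (fun x y => t x y ^+ 2) +
                        2 * edge_sum B (fun x y => t' x y ^+ 2))); last first.
  by have := H B; have := H' B; lra.
rewrite -!edge_sumZ -edge_sumD; apply: edge_sum_le => x y _ _ _.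
by have := sqr_ge0 (t x y - t' x y); rewrite !expr2; nra.
Qed.

Lemma square_boundZ t C (c : R) : square_bound t C ->
  square_bound (fun x y => c * t x y) (c ^+ 2 * C).
Proof.
move=> H B; have := ler_wpM2l (sqr_ge0 c) (H B); rewrite -edge_sumZ.
by under edge_sum_eq => x y do rewrite -exprMn.
Qed.

(** Beyond the hull of the support the edge sums are constant, by summation by
    parts. *)
Lemma supported_square_bound A f : supported A f ->
  square_bound (grad f) (edge_sum (hull A) (fun x y => grad f x y ^+ 2)).
Proof.
move=> fA B.
have sq x y : grad f x y ^+ 2 = grad f x y * grad f x y by rewrite expr2.
have ga x y : grad f x y = - grad f y x by rewrite /grad opprB.
pose B' := (B `|` hull A)%fset.
apply: (@le_trans _ _ (edge_sum B' (fun x y => grad f x y ^+ 2))).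
  by apply: edge_sum_mono => [|x y]; [exact: fsubsetUl | exact: sqr_ge0].
by under edge_sum_eq => x y do rewrite sq; under [leRHS]edge_sum_eq => x y do rewrite sq;
  rewrite !(edge_sum_by_parts _ fA ga) // fsubsetUr.
Qed.

End DirichletSums.

(** * Almost minimizers of the energy *)

Lemma ultra_fmap (T U : Type) (f : T -> U) (F : set_system T) :
  UltraFilter F -> UltraFilter (fmap f F).
Proof.
move=> FU; split; first exact: fmap_proper_filter.
move=> G GF FG; rewrite predeqE => A; split; last exact: FG.
move=> GA; have [//|FnA] := in_ultra_setVsetC (f @^-1` A) FU.
have GnA : G (~` A) by apply: FG.
by exfalso; apply: (@filter_not_empty _ G _); rewrite -(setICr A); apply: filterI.
Qed.

(** Minimization of the energy among the functions that differ from [f0] at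
    finitely many vertices, and not on [O]. With [O] a point and [f0] the unit
    mass there, the minimum is a capacity and the limit is a Green function;
    with [O] empty, the limit is the harmonic part of [f0] in the Royden
    decomposition. *)
Section Minimizer.
Context (R : realType) (V : choiceType) (N : V -> {fset V}).
Hypothesis Nsym : forall u v, (u \in N v) = (v \in N u).
Context (f0 : V -> R) (C0 : R) (hf0 : square_bound N (grad f0) C0).
Context (O : V -> Prop) (lo hi : R) (f0_bd : forall x, lo <= f0 x <= hi).

Definition competitor (u : V -> R) : Prop :=
  (exists A : {fset V}, supported A (fun x => u x - f0 x)) /\
  (forall x, O x -> u x = f0 x).
Definition min_energy : R :=
  inf [set C | exists2 u, competitor u & square_bound N (grad u) C].

Let energies := [set C | exists2 u, competitor u & square_bound N (grad u) C].

Lemma competitor0 : competitor f0.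
Proof. by split=> //; exists fset0 => x _; rewrite subrr. Qed.

Lemma energies_has_inf : has_inf energies.
Proof.
split; first by exists C0; exists f0 => //; apply: competitor0.
by exists 0 => C [u _ /square_bound_ge0].
Qed.

Lemma min_energy_le u C : competitor u -> square_bound N (grad u) C ->
  min_energy <= C.
Proof. by move=> cu uC; apply: ge_inf; [case: energies_has_inf|exists u]. Qed.

Lemma min_energy_ge0 : 0 <= min_energy.
Proof.
apply: lb_le_inf; first by case: energies_has_inf.
by move=> C [u _ /square_bound_ge0].
Qed.

Definition clamp (x : R) : R := Num.max lo (Num.min hi x).

Lemma clamp_lip x y : `|clamp y - clamp x| <= `|y - x|.
Proof.
wlog xy : x y / x <= y.
  by move=> H; have [/H//|/ltW/H] := leP x y; rewrite !(distrC y) !(distrC (clamp y)).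
rewrite (ger0_norm (x := y - x)) ?subr_ge0 //.
rewrite /clamp ler_norml.
case: (leP hi x) => ?; case: (leP hi y) => ?; case: (leP lo hi) => ?;
  case: (leP lo x) => ?; case: (leP lo y) => ?; lra.
Qed.

(** Truncation decreases the energy. *)
Lemma near_minimizer (d : R) : 0 < d -> exists u,
  [/\ competitor u, square_bound N (grad u) (min_energy + d)
    & forall x, lo <= u x <= hi].
Proof.
move=> d0; have [C [u [[A uA] uO] uC] Cd] := inf_adherent d0 energies_has_inf.
exists (clamp \o u); split; last 1 first.
- move=> x; have /andP[h1 h2] := f0_bd x.
  by rewrite /= /clamp le_max lexx ge_max (le_trans h1 h2) ge_min lexx.
- have cf0 x : clamp (f0 x) = f0 x.
    have /andP[h1 h2] := f0_bd x.
    by rewrite /clamp (min_idPr h2) (max_idPr h1).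
  split; last by move=> x Ox; rewrite /= uO.
  exists A => x /uA ux; have -> : (clamp \o u) x = f0 x.
    by rewrite /= -[RHS]cf0; congr clamp; lra.
  by rewrite subrr.
have := square_bound_le uC (ltW Cd).
move/square_bound_mono; apply => x y _; exact: clamp_lip.
Qed.

Lemma edge_sum_grad_lin u z (t : R) (B : {fset V}) :
  edge_sum N B (fun x y => grad (fun w => u w + t * z w) x y ^+ 2) =
    edge_sum N B (fun x y => grad u x y ^+ 2) +
    2 * t * edge_sum N B (fun x y => grad u x y * grad z x y) +
    t ^+ 2 * edge_sum N B (fun x y => grad z x y ^+ 2).
Proof.
by rewrite -!edge_sumZ -!edge_sumD; apply: edge_sum_eq => x y _ _ _; rewrite /grad; ring.
Qed.

Lemma grad_anti (u : V -> R) x y : grad u x y = - grad u y x :> R.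
Proof. by rewrite /grad opprB. Qed.

(** First variation of the energy, at an almost minimizer: for all [t] the
    competitor [u + t z] has at least the minimal energy. *)
Lemma near_minimizer_variation u (d : R) z A D : competitor u ->
  square_bound N (grad u) (min_energy + d) -> supported A z ->
  (forall x, O x -> z x = 0) -> square_bound N (grad z) D ->
  forall t, 4 * t * \sum_(x <- A) z x * laplacian N u x <= d + t ^+ 2 * D.
Proof.
move=> [[A' uA'] uO] ud zA zO zD t.
set p := \sum_(x <- A) _.
have cv : competitor (fun w => u w + t * z w).
  split=> [|x Ox]; last by rewrite zO // mulr0 addr0 uO.
  exists (A `|` A')%fset => x; rewrite inE negb_or => /andP[xA xA'].
  by rewrite zA // mulr0 addr0 uA'.
have ga x y : grad u x y = - grad u y x by exact: grad_anti.
suff : min_energy <= min_energy + d - 4 * t * p + t ^+ 2 * D by lra.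
apply: (min_energy_le cv) => B.
pose B' := (B `|` hull N A)%fset.
apply: (@le_trans _ _ (edge_sum N B'
    (fun x y => grad (fun w => u w + t * z w) x y ^+ 2))).
  by apply: edge_sum_mono => [|x y]; [exact: fsubsetUl | exact: sqr_ge0].
rewrite edge_sum_grad_lin (edge_sum_by_parts Nsym _ zA ga) ?fsubsetUr //.
have := ud B'; have := ler_wpM2l (sqr_ge0 t) (zD B').
by rewrite -/p; lra.
Qed.

(** Parallelogram law: almost minimizers are close to one another. *)
Lemma near_minimizer_close u u' (d d' : R) : competitor u -> competitor u' ->
  square_bound N (grad u) (min_energy + d) ->
  square_bound N (grad u') (min_energy + d') ->
  square_bound N (grad (fun x => u x - u' x)) (2 * d + 2 * d').
Proof.
move=> [[A uA] uO] [[A' uA'] uO'] hu hu' B.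
pose w x := 2^-1 * (u x + u' x).
have cw : competitor w.
  split=> [|x Ox]; last by rewrite /w uO // uO' //; lra.
  exists (A `|` A')%fset => x; rewrite inE negb_or => /andP[/uA h1 /uA' h2].
  by rewrite /w; lra.
apply/ler_addgt0Pr => e e0.
have [B1 hB1] : exists B1, min_energy - e / 4 < edge_sum N B1 (fun x y => grad w x y ^+ 2).
  apply: contrapT => nB; have /(min_energy_le cw) : square_bound N (grad w) (min_energy - e / 4).
    by move=> B1; rewrite leNgt; apply/negP => ?; apply: nB; exists B1.
  by lra.
pose B' := (B `|` B1)%fset.
apply: (@le_trans _ _ (edge_sum N B'
    (fun x y => grad (fun x => u x - u' x) x y ^+ 2))).
  by apply: edge_sum_mono => [|x y]; [exact: fsubsetUl | exact: sqr_ge0].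
have hB' : min_energy - e / 4 < edge_sum N B' (fun x y => grad w x y ^+ 2).
  apply: lt_le_trans hB1 _.
  by apply: edge_sum_mono => [|x y]; [exact: fsubsetUr | exact: sqr_ge0].
have -> : edge_sum N B' (fun x y => grad (fun x => u x - u' x) x y ^+ 2) =
   2 * edge_sum N B' (fun x y => grad u x y ^+ 2) +
   2 * edge_sum N B' (fun x y => grad u' x y ^+ 2) +
   (- 4) * edge_sum N B' (fun x y => grad w x y ^+ 2).
  by rewrite -!edge_sumZ -!edge_sumD; apply: edge_sum_eq => x y _ _ _;
    rewrite /grad /w; field.
by have := hu B'; have := hu' B'; lra.
Qed.

Lemma cvg_edge_sum (F : set_system nat) {FF : ProperFilter F} (t_ : nat -> V -> V -> R)
    (t : V -> V -> R) B : (forall x y, t_ n x y @[n --> F] --> t x y) ->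
  edge_sum N B (t_ n) @[n --> F] --> edge_sum N B t.
Proof.
move=> H; rewrite /edge_sum; apply: cvg_big => [|x _]; first exact: add_continuous.
by apply: cvg_big => [|y _]; first exact: add_continuous.
Qed.

Lemma cvg_square_bound (F : set_system nat) {FF : ProperFilter F}
    (t_ : nat -> V -> V -> R) (t : V -> V -> R) (c_ : nat -> R) (c : R) :
  (forall x y, t_ n x y @[n --> F] --> t x y) -> c_ n @[n --> F] --> c ->
  (\forall n \near F, square_bound N (t_ n) (c_ n)) -> square_bound N t c.
Proof.
move=> Ht Hc HF B.
have Hs : edge_sum N B (fun x y => t_ n x y ^+ 2) @[n --> F] -->
    edge_sum N B (fun x y => t x y ^+ 2).
  apply: (@cvg_edge_sum F _ (fun n x y => t_ n x y ^+ 2)) => x y.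
  by rewrite expr2; under eq_fun do rewrite expr2; apply: cvgM.
by apply: (ler_cvg_to Hs Hc); apply: filterS HF => n; apply.
Qed.

(** An ultrafilter spares the extraction of a subsequence that converges at
    each vertex. *)
Lemma minimizing_sequence : exists (F : set_system nat) (u_ : nat -> V -> R) (g : V -> R),
  [/\ ProperFilter F, F `=>` \oo,
     forall n, [/\ competitor (u_ n),
        square_bound N (grad (u_ n)) (min_energy + n.+1%:R^-1)
        & forall x, lo <= u_ n x <= hi]
   & forall x, u_ n x @[n --> F] --> g x].
Proof.
have ex n : exists u, [/\ competitor u,
   square_bound N (grad u) (min_energy + n.+1%:R^-1) & forall x, lo <= u x <= hi].
  by apply: near_minimizer; rewrite invr_gt0.
have [u_ Hu] := choice ex.
have [F [UF Foo]] := ultraFilterLemma (@eventually_filter).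
have PF : ProperFilter F by case: UF.
have lim x : exists l : R, u_ n x @[n --> F] --> l.
  have : compact `[lo, hi] by apply: segment_compact.
  rewrite compact_ultra => /(_ (fmap (u_ ^~ x) F)).
  have UI : UltraFilter (fmap (u_ ^~ x) F) by apply: ultra_fmap.
  move=> /(_ UI) [].
    by apply: nearW => n; have [_ _ /(_ x)] := Hu n; rewrite /= in_itv.
  by move=> l [_ Hl]; exists l.
have [g Hg] := choice lim.
by exists F, u_, g.
Qed.

End Minimizer.

(** * Limits of minimizing sequences *)

Lemma zero_of_quadratic (R : realType) (L D : R) : 0 <= D ->
  (forall t, 4 * t * L <= t ^+ 2 * D) -> L = 0.
Proof.
move=> D0 H; have := H (L / (D + 1)).
have D1 : 0 < D + 1 by lra.
have -> : 4 * (L / (D + 1)) * L = (4 * L ^+ 2 * (D + 1)) / (D + 1) ^+ 2.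
  by field; apply: lt0r_neq0.
have -> : (L / (D + 1)) ^+ 2 * D = (L ^+ 2 * D) / (D + 1) ^+ 2.
  by field; apply: lt0r_neq0.
rewrite ler_pM2r ?invr_gt0 ?exprn_gt0 // => h.
have L2 := sqr_ge0 L; apply/eqP; rewrite -sqrf_eq0 eq_le L2 andbT; nra.
Qed.

Section Limits.
Context (R : realType) (V : choiceType) (N : V -> {fset V}).
Hypothesis Nsym : forall u v, (u \in N v) = (v \in N u).

Lemma cvg_laplacian (F : set_system nat) {FF : ProperFilter F}
    (u_ : nat -> V -> R) (g : V -> R) x : (forall x, u_ n x @[n --> F] --> g x) ->
  laplacian N (u_ n) x @[n --> F] --> laplacian N g x.
Proof.
move=> H; rewrite /laplacian /divergence.
apply: cvg_big => [|y _]; first exact: add_continuous.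
by apply: cvgB; apply: H.
Qed.

Lemma cvg_inv_succ (F : set_system nat) {FF : ProperFilter F} : F `=>` \oo ->
  n.+1%:R^-1 @[n --> F] --> (0 : R).
Proof. by move=> Foo; apply: cvg_trans (@cvg_harmonic R); apply: cvg_app. Qed.

Definition point_mass (o x : V) : R := (x == o)%:R.

Lemma point_mass_supported o : supported [fset o]%fset (point_mass o).
Proof. by move=> x; rewrite inE /point_mass => /negPf ->. Qed.

Context (f0 : V -> R) (C0 : R) (hf0 : square_bound N (grad f0) C0).
Context (O : V -> Prop) (lo hi : R) (f0_bd : forall x, lo <= f0 x <= hi).
Let m := min_energy N f0 O.

(** The bound on the energy passes to the limit by finiteness of the sums;
    harmonicity off [O] is the limit of the first variation at point masses. *)
Lemma minimizer_limit : exists (F : set_system nat) (u_ : nat -> V -> R) (g : V -> R),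
  [/\ ProperFilter F, F `=>` \oo,
     forall n, [/\ competitor f0 O (u_ n),
        square_bound N (grad (u_ n)) (m + n.+1%:R^-1)
        & forall x, lo <= u_ n x <= hi]
   & forall x, u_ n x @[n --> F] --> g x] /\
  [/\ square_bound N (grad g) m, forall x, lo <= g x <= hi,
     forall x, O x -> g x = f0 x, forall x, ~ O x -> laplacian N g x = 0
   & forall n, square_bound N (grad (fun x => u_ n x - g x)) (2 * n.+1%:R^-1)].
Proof.
have [F [u_ [g [PF Foo Hu Hg]]]] := minimizing_sequence hf0 O f0_bd.
exists F, u_, g; split=> //.
have inv0 := @cvg_inv_succ F PF Foo.
have gradcvg x y : grad (u_ n) x y @[n --> F] --> grad g x y.
  by apply: cvgB; apply: Hg.
split.
- apply: (cvg_square_bound gradcvg (c_ := fun n => m + n.+1%:R^-1)).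
    have := cvgD (@cvg_cst _ m _ F _) inv0; rewrite addr0; exact.
  by apply: nearW => n; have [] := Hu n.
- move=> x; apply/andP; split.
    apply: (cvgr_to_ge (Hg x)); apply: nearW => n.
    by have [_ _ /(_ x)/andP[]] := Hu n.
  apply: (cvgr_to_le (Hg x)); apply: nearW => n.
  by have [_ _ /(_ x)/andP[]] := Hu n.
- move=> x Ox; apply: (cvg_unique _ (Hg x)) => //.
  apply: cvg_near_cst; apply: nearW => n.
  by have [[_ ->]] := Hu n.
- move=> x nOx.
  have := supported_square_bound Nsym (@point_mass_supported x).
  set D := edge_sum _ _ _ => HD; have D0 := square_bound_ge0 HD.
  apply: (zero_of_quadratic D0) => t.
  have hn n : 4 * t * laplacian N (u_ n) x <= n.+1%:R^-1 + t ^+ 2 * D.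
    have [cu ub _] := Hu n.
    have := near_minimizer_variation Nsym hf0 cu ub (@point_mass_supported x) _ HD t.
    rewrite big_seq_fset1 /point_mass eqxx mul1r; apply.
    by move=> y Oy; case: eqVneq => // E; case: nOx; rewrite -E.
  have h1 : 4 * t * laplacian N (u_ n) x @[n --> F] --> 4 * t * laplacian N g x.
    by apply: cvgM; [exact: cvg_cst | exact: cvg_laplacian].
  have h2 : n.+1%:R^-1 + t ^+ 2 * D @[n --> F] --> 0 + t ^+ 2 * D.
    by apply: cvgD => //; apply: cvg_cst.
  by rewrite -[leRHS]add0r; apply: (ler_cvg_to h1 h2); apply: nearW.
move=> n.
apply: (@cvg_square_bound _ _ _ F _ (fun k => grad (fun x => u_ n x - u_ k x)) _
  (fun k => 2 * n.+1%:R^-1 + 2 * k.+1%:R^-1)).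
- move=> x y; apply: cvgB; apply: cvgB; try exact: cvg_cst; exact: Hg.
- rewrite -[X in _ --> X]addr0; apply: cvgD; first exact: cvg_cst.
  by rewrite -[X in _ --> X](mulr0 2); apply: cvgM => //; apply: cvg_cst.
apply: nearW => k; have [cn hn _] := Hu n; have [ck hk _] := Hu k.
have := near_minimizer_close hf0 cn ck hn hk; exact.
Qed.

End Limits.

(** * Capacity and the Green function *)

Section Green.
Context (R : realType) (V : choiceType) (N : V -> {fset V}).
Hypothesis Nsym : forall u v, (u \in N v) = (v \in N u).
Hypothesis connected : forall (A : V -> Prop) o, A o ->
    (forall u v, A u -> v \in N u -> A v) -> forall v, A v.

(** The capacity between [o] and infinity, up to the factor due to counting
    both orientations of the edges. *)
Definition capacity (o : V) : R := min_energy N (point_mass R o) (eq o).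

Context (o : V) (cap_gt0 : 0 < capacity o).
Let m := capacity o.
Let hpm := supported_square_bound Nsym (@point_mass_supported R V o).

Lemma point_mass_bd x : 0 <= point_mass R o x <= 1.
Proof. by rewrite /point_mass; case: eqVneq => _ /=; rewrite ?lexx ?ler01. Qed.

Lemma pairing_point_mass (A : {fset V}) (F : V -> R) : o \in A ->
  \sum_(x <- A) point_mass R o x * F x = F o.
Proof.
move=> oA; rewrite (bigD1_seq o) //= ?fset_uniq // big1 ?addr0.
  by rewrite /point_mass eqxx mul1r.
by move=> x /negPf xo; rewrite /point_mass xo mul0r.
Qed.

Lemma competitor_supported u : competitor (point_mass R o) (eq o) u ->
  exists2 A : {fset V}, o \in A & supported A u.
Proof.
move=> [[A uA] _]; exists (o |` A)%fset; first by rewrite !inE eqxx.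
move=> x; rewrite !inE negb_or => /andP[/negPf xo /uA].
by rewrite /point_mass xo subr0.
Qed.

Lemma competitor_at u : competitor (point_mass R o) (eq o) u -> u o = 1.
Proof. by move=> [_ /(_ o erefl) ->]; rewrite /point_mass eqxx. Qed.

(** The first variation at [u] in the direction [z - u], which vanishes at
    [o]. *)
Lemma pairing_near_minimizer u d z A D : competitor (point_mass R o) (eq o) u ->
  square_bound N (grad u) (m + d) -> supported A u -> supported A z -> z o = 1 ->
  square_bound N (grad z) D -> forall s, 0 < s ->
  `|\sum_(x <- A) z x * laplacian N u x - \sum_(x <- A) u x * laplacian N u x|
    <= d / (4 * s) + s * (2 * D + 2 * (m + d)) / 4.
Proof.
move=> cu hu uA zA z1 hz s s0.
have wA : supported A (fun x => z x - u x).
  by move=> x xA; rewrite zA // uA // subrr.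
have wo x : o = x -> z x - u x = 0.
  by move=> <-; rewrite z1 (competitor_at cu) subrr.
have hw : square_bound N (grad (fun x => z x - u x)) (2 * D + 2 * (m + d)).
  have hu' : square_bound N (fun x y => -1 * grad u x y) (m + d).
    by have := square_boundZ (-1) hu; rewrite sqrrN expr1n mul1r.
  have := square_boundD hz hu' => H B; apply: le_trans (H B).
  by apply: edge_sum_le => x y _ _ _; rewrite /grad le_eqVlt; apply/orP; left;
     apply/eqP; congr (_ ^+ 2); ring.
have := near_minimizer_variation Nsym hpm cu hu wA wo hw.
have -> : \sum_(x <- A) (z x - u x) * laplacian N u x =
   \sum_(x <- A) z x * laplacian N u x - \sum_(x <- A) u x * laplacian N u x.
  by rewrite -sumrB; apply: eq_bigr => x _; rewrite mulrBl.
set p := (X in `|X|); set E := 2 * D + _ => H0.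
have H t : 4 * t * p <= d + t ^+ 2 * E := H0 t.
have e : d / (4 * s) + s * E / 4 = (d + s ^+ 2 * E) / (4 * s).
  by field; apply: lt0r_neq0.
have H1 := H s; have H2 := H (- s); rewrite sqrrN in H2.
rewrite e ler_norml lerNl; apply/andP; split; rewrite ler_pdivlMr ?mulr_gt0 //; lra.
Qed.

Lemma pairing_self u d A : competitor (point_mass R o) (eq o) u ->
  square_bound N (grad u) (m + d) -> supported A u ->
  m <= - 2 * \sum_(x <- A) u x * laplacian N u x <= m + d.
Proof.
move=> cu hu uA; have ga x y : grad u x y = - grad u y x by exact: grad_anti.
rewrite -(edge_sum_by_parts Nsym (fsubset_refl _) uA ga).
under edge_sum_eq => x y do rewrite -expr2.
rewrite hu andbT; apply: (min_energy_le hpm cu).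
exact: (supported_square_bound Nsym uA).
Qed.

Lemma small_choice (M c : R) : 0 <= M -> 0 < c -> exists2 s, 0 < s & s * M <= c.
Proof.
move=> M0 c0; exists (c / (M + 1)); first by rewrite divr_gt0 //; lra.
rewrite mulrAC ler_pdivrMr; last lra.
by rewrite ler_pM2l //; lra.
Qed.

(** The Green function [g] with pole [o], up to a factor, and cutoffs along its
    level sets. For a cutoff [chi = min (g / e) 1] the sum of
    [|grad g| |grad chi|] would be the flux of [g], as the two gradients have the
    same sign; but such a cutoff need not have finite support. In the proof [g]
    is therefore replaced there by an almost minimizer [u], chosen after the
    level [e], so close to [g] that the sum increases by less than 1. *)
Lemma green_function : exists g : V -> R,
  [/\ square_bound N (grad g) m, forall x, 0 < g x,
      forall x, x != o -> laplacian N g x = 0, laplacian N g o < 0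
    & forall A1 : {fset V}, exists chi : V -> R,
      [/\ exists A, supported A chi, forall x, 0 <= chi x <= 1,
         forall x, x \in A1 -> chi x = 1
       & forall B, edge_sum N B (fun x y => `|grad g x y| * `|grad chi x y|) <= m + 1]].
Proof.
have [F [u_ [g [[PF Foo Hu Hg] [gE gbd gO glap close]]]]] :=
  minimizer_limit Nsym hpm (eq o) point_mass_bd.
have gO1 : g o = 1 by rewrite gO // /point_mass eqxx.
have lap0 x : x != o -> laplacian N g x = 0.
  by move=> xo; apply: glap => E; rewrite E eqxx in xo.
have m0 : 0 < m := cap_gt0.
have inv1 n : n.+1%:R^-1 <= 1 :> R by rewrite invf_le1 // ler1n.
(* A zero of [g] would spread to its neighbours, and so to [o]. *)
have gpos x : 0 < g x.
  rewrite lt_neqAle; have /andP[-> _] := gbd x; rewrite andbT eq_sym.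
  apply/eqP => gx; suff : g o = 0 by rewrite gO1 => /eqP; rewrite oner_eq0.
  apply: (connected (A := fun w => g w = 0) gx) => u v gu vu.
  have uo : u != o by apply/eqP => E; move: gu; rewrite E gO1 => /eqP; rewrite oner_eq0.
  have := lap0 u uo; rewrite /laplacian /divergence /grad gu.
  under eq_bigr do rewrite subr0.
  rewrite big_seq_cond => /eqP; rewrite psumr_eq0; last by move=> i _; case/andP: (gbd i).
  by move/allP => /(_ v vu); rewrite vu /= => /eqP.
exists g; split=> //.
  have [D D0 HD] : exists2 D, 0 <= D & square_bound N (grad (point_mass R o)) D.
    by eexists; [exact: square_bound_ge0 hpm| exact: hpm].
  have [s s0 sM] := small_choice (ltac:(lra) : 0 <= (2 * D + 2 * (m + 1)) / 4)
    (ltac:(lra) : 0 < m / 8).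
  have cv1 := @cvg_laplacian _ _ N F PF _ _ o Hg.
  have cv2 : m / 2 - (n.+1%:R^-1 * (4 * s)^-1 + m / 8) @[n --> F] --> m / 2 - (0 * (4 * s)^-1 + m / 8).
    apply: cvgB; first exact: cvg_cst.
    apply: cvgD; last exact: cvg_cst.
    by apply: cvgM; [exact: cvg_inv_succ | exact: cvg_cst].
  have : m / 2 - (0 * (4 * s)^-1 + m / 8) <= - laplacian N g o; last by lra.
  apply: (ler_cvg_to cv2 (cvgN cv1)); apply: nearW => n.
  have [cu hu ub] := Hu n; have [A oA uA] := competitor_supported cu.
  have := inv1 n; move: hu; rewrite /=; set d' : R := n.+1%:R^-1 => hu d'1.
  have pA : supported A (point_mass R o).
    by move=> x xA; rewrite /point_mass; case: eqVneq => // E; rewrite E oA in xA.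
  have p1 : point_mass R o o = 1 by rewrite /point_mass eqxx.
  have := pairing_near_minimizer cu hu uA pA p1 HD s0.
  have /andP[h1 _] := pairing_self cu hu uA.
  rewrite pairing_point_mass // ler_norml => /andP[_ h2].
  have h3 : s * (2 * D + 2 * (m + d')) / 4 <= m / 8.
    by apply: le_trans sM; rewrite -mulrA ler_pM2l //; lra.
  change (m / 2 - (d' / (4 * s) + m / 8) <= - laplacian N (u_ n) o); lra.
move=> A1.
have [e [e0 e1 eA]] : exists e, [/\ 0 < e, e < 1 & forall x, x \in A1 -> e < g x].
  have : forall s : seq V, exists e : R, [/\ 0 < e, e < 1 & forall x, x \in s -> e < g x].
    elim=> [|a s [e [e0 e1 es]]]; first by exists 2^-1; split=> //; lra.
    exists (Num.min e (g a / 2)); split.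
    - by rewrite lt_min e0 divr_gt0.
    - by rewrite gt_min e1.
    move=> x; rewrite inE => /orP[/eqP ->|/es xs]; rewrite gt_min ?xs //.
    by apply/orP; right; have := gpos a; lra.
  by move/(_ A1).
pose L := (m + 1) / e ^+ 2.
have L0 : 0 <= L by rewrite divr_ge0 ?sqr_ge0 //; lra.
(* [s], [c'] and then [d] are the weights and the precision that make the error
   terms below 1. *)
have [s s0 sM] := small_choice (ltac:(lra) : 0 <= (2 * L + 2 * (m + 1)) / 4)
    (ltac:(lra) : (0:R) < 1 / 16).
have [c' c'0 c'L] := small_choice L0 (ltac:(lra) : (0:R) < 1 / 4).
pose Q := 1 + (2 * s)^-1 + 2 * c'^-1.
have Q0 : 0 <= Q by rewrite !addr_ge0 // ?mulr_ge0 // invr_ge0 ?mulr_ge0 // ltW.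
have [d d0 dQ] := small_choice Q0 (ltac:(lra) : (0:R) < 1 / 4).
have near_d : \forall n \near F, n.+1%:R^-1 < d.
  exact: (cvgr_lt _ (@cvg_inv_succ R F PF Foo)).
have near_A : \forall n \near F, forall x, x \in A1 -> e < u_ n x.
  have : forall s : seq V, {subset s <= A1} -> \forall n \near F, forall x, x \in s -> e < u_ n x.
    elim=> [|a t IH] st; first by apply: nearW.
    have ta : \forall n \near F, e < u_ n a.
      by apply: (cvgr_gt _ (Hg a)); apply: eA; apply: st; rewrite inE eqxx.
    have tt := IH (fun x xt => st x (ltac:(by rewrite inE xt orbT))).
    apply: filterS2 ta tt => n h1 h2 x; rewrite inE => /orP[/eqP ->//|]; exact: h2.
  by move/(_ A1); apply.
have [n [nd nA]] := filter_ex (filterI near_d near_A).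
have [cu hu ub] := Hu n; have [A oA uA] := competitor_supported cu.
set u := u_ n in nA cu hu ub uA.
set d' : R := n.+1%:R^-1 in nd hu.
have d'0 : 0 < d' by rewrite invr_gt0.
have d'1 : d' <= 1 := inv1 n.
pose chi x := Num.min (u x / e) 1.
have chiA : supported A chi.
  by move=> x xA; rewrite /chi uA // mul0r (min_idPl ler01).
have chi_bd x : 0 <= chi x <= 1.
  rewrite /chi le_min ge_min lexx orbT ler01 !andbT.
  by apply: divr_ge0; [case/andP: (ub x) | exact: ltW].
have chi1 x : e <= u x -> chi x = 1.
  by move=> h; apply/min_idPr; rewrite ler_pdivlMr // mul1r.
have chi_o : chi o = 1.
  by apply: chi1; rewrite (competitor_at cu) ltW.
have chi_mono x y : u x <= u y -> 0 <= grad chi x y <= e^-1 * grad u x y.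
  move=> uxy; have h : u x / e <= u y / e by rewrite ler_pM2r ?invr_gt0.
  rewrite /grad /chi mulrBr ![e^-1 * _]mulrC.
  by case: (leP (u x / e)); case: (leP (u y / e)) => *; apply/andP; split; lra.
have sgn x y : `|grad u x y| * `|grad chi x y| = grad u x y * grad chi x y /\
    `|grad chi x y| <= e^-1 * `|grad u x y|.
  wlog xy : x y / u x <= u y.
    move=> H; have [/H//|/ltW/H] := leP (u x) (u y).
    by rewrite ![grad _ y x]grad_anti !normrN mulrNN.
  have /andP[h1 h2] := chi_mono x y xy.
  have h3 : 0 <= grad u x y by rewrite /grad subr_ge0.
  by rewrite !ger0_norm.
have chiE : square_bound N (grad chi) L.
  have := square_boundZ e^-1 hu => H B; apply: (@le_trans _ _ (e^-1 ^+ 2 * (m + d'))).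
    apply: le_trans (H B); apply: edge_sum_le => x y _ _ _.
    have [_ h] := sgn x y.
    rewrite -(real_normK (num_real (grad chi x y))).
    rewrite -(real_normK (num_real (e^-1 * grad u x y))) lerXn2r ?nnegrE //.
    by rewrite normrM (gtr0_norm (x := e^-1)) // invr_gt0.
  rewrite /L mulrC exprVn ler_pM2r ?invr_gt0 ?exprn_gt0 //.
  by lra.
exists chi; split=> //.
- by exists A.
- by move=> x /nA h; apply: chi1; apply: ltW.
move=> B.
pose B' := (B `|` hull N A)%fset.
apply: (@le_trans _ _ (edge_sum N B' (fun x y => `|grad g x y| * `|grad chi x y|))).
  by apply: edge_sum_mono => [|x y]; [exact: fsubsetUl | exact: mulr_ge0].
apply: (@le_trans _ _ (edge_sum N B' (fun x y => grad u x y * grad chi x y +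
   `|grad (fun x => u x - g x) x y| * `|grad chi x y|))).
  apply: edge_sum_le => x y _ _ _; have [<- _] := sgn x y.
  rewrite -mulrDl ler_wpM2r //.
  have -> : grad g x y = grad u x y - grad (fun x => u x - g x) x y.
    by rewrite /grad; ring.
  exact: ler_normB.
rewrite edge_sumD.
have ga x y : grad u x y = - grad u y x by exact: grad_anti.
rewrite (edge_sum_by_parts Nsym _ chiA ga) ?fsubsetUr //.
have := pairing_near_minimizer cu hu uA chiA chi_o chiE s0.
have /andP[_ h1] := pairing_self cu hu uA.
rewrite ler_norml => /andP[h2 _].
have := edge_sum_amgm N B' (grad (fun x => u x - g x)) (grad chi) (ltac:(by rewrite invr_gt0) : 0 < c'^-1).
rewrite invrK => h3.
have h4 := close n B'; rewrite -/u -/d' in h4.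
have h5 := chiE B'.
have h6 : c'^-1 * edge_sum N B' (fun x y => grad (fun x => u x - g x) x y ^+ 2) <= c'^-1 * (2 * d').
  by rewrite ler_pM2l ?invr_gt0.
have h7 : c' * edge_sum N B' (fun x y => grad chi x y ^+ 2) <= c' * L by rewrite ler_pM2l.
have h8 : s * (2 * L + 2 * (m + d')) / 4 <= 1 / 16.
  by apply: le_trans sM; rewrite -mulrA ler_pM2l //; lra.
have h9 : d' * Q <= 1 / 4.
  by apply: le_trans dQ; rewrite ler_wpM2r // ltW.
have h10 : d' / (4 * s) * 2 = d' * (2 * s)^-1 by field; apply: lt0r_neq0.
rewrite /Q !mulrDr mulr1 in h9.
have h11 : 0 <= d' * c'^-1 by rewrite mulr_ge0 ?invr_ge0 ?ltW.
rewrite /laplacian in h1 h2 *; lra.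
Qed.

End Green.

(** * Vertices of zero capacity *)

Section ZeroCapacity.
Context (R : realType) (V : choiceType) (N : V -> {fset V}).
Hypothesis Nsym : forall u v, (u \in N v) = (v \in N u).
Hypothesis connected : forall (A : V -> Prop) o, A o ->
    (forall u v, A u -> v \in N u -> A v) -> forall v, A v.

Lemma edge_term_le (B : {fset V}) (t : V -> V -> R) x y :
  (forall x y, 0 <= t x y) -> x \in B -> y \in B -> y \in N x ->
  t x y <= edge_sum N B t.
Proof.
move=> t0 xB yB yx; rewrite /edge_sum (bigD1_seq x) //= ?fset_uniq //.
rewrite (big_rem y) //= yx -addrA ler_wpDr // addr_ge0 //.
  by apply: sumr_ge0.
by apply: sumr_ge0 => i _; apply: sumr_ge0.
Qed.

Lemma square_bound0_const (g : V -> R) : square_bound N (grad g) 0 ->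
  forall x y, g x = g y.
Proof.
move=> g0 x y; apply: (connected (A := fun x => g x = g y) (o := y) erefl) => u v <- vu.
have := le_trans (@edge_term_le [fset u; v]%fset (fun x y => grad g x y ^+ 2) u v
  (fun _ _ => sqr_ge0 _) _ _ vu) (g0 _).
rewrite !inE !eqxx orbT => /(_ isT isT) h.
have : grad g u v ^+ 2 = 0 by apply/eqP; rewrite eq_le h sqr_ge0.
by move/eqP; rewrite sqrf_eq0 /grad subr_eq0 => /eqP.
Qed.

(** A bounded function that vanishes at a vertex of zero capacity and is
    harmonic elsewhere vanishes: test harmonicity against [W u^2], where [u] is
    a cutoff of small energy, as in Caccioppoli's inequality. *)
Lemma zero_capacity_liouville (o : V) (W : V -> R) : capacity R N o <= 0 ->
  (forall x, 0 <= W x <= 1) -> W o = 0 ->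
  (forall x, x != o -> laplacian N W x = 0) -> forall x, W x = 0.
Proof.
move=> cap0 W01 Wo Wlap.
have hpm := supported_square_bound Nsym (@point_mass_supported R V o).
have [F [u_ [g [[PF Foo Hu Hg] [gE _ gO _ _]]]]] :=
  minimizer_limit Nsym hpm (eq o) (@point_mass_bd R V o).
have m0 : min_energy N (point_mass R o) (eq o) = 0.
  by apply/eqP; rewrite eq_le cap0 (min_energy_ge0 hpm).
rewrite m0 in gE.
have g1 x : g x = 1.
  by rewrite (square_bound0_const gE x o) gO // /point_mass eqxx.
suff dW : forall x y, y \in N x -> W y = W x.
  move=> x; apply: (connected (A := fun x => W x = 0) Wo) => u v Wu /dW ->.
  exact: Wu.
move=> x y yx.
have key n : (u_ n x ^+ 2 + u_ n y ^+ 2) * grad W x y ^+ 2 <= 8 * n.+1%:R^-1.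
  have [cu] := Hu n; rewrite m0 add0r; set u := u_ n => hu ub.
  have [A oA uA] := competitor_supported cu.
  pose phi z := W z * u z ^+ 2.
  have phiA : supported A phi by move=> z zA; rewrite /phi (uA z zA : u z = 0) expr0n mulr0.
  pose B := ((hull N A) `|` [fset x; y])%fset.
  have ga z w : grad W z w = - grad W w z by exact: grad_anti.
  have E0 : edge_sum N B (fun z w => grad W z w * grad phi z w) = 0.
    rewrite (edge_sum_by_parts Nsym _ phiA ga) ?fsubsetUl //.
    rewrite big1 ?mulr0 // => z _; rewrite /phi.
    by have [->|zo] := eqVneq z o; [rewrite Wo !mul0r|rewrite -/(laplacian N W z) Wlap // mulr0].
  have le1 : edge_sum N B (fun z w => (u z ^+ 2 + u w ^+ 2) * grad W z w ^+ 2) <=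
      8 * edge_sum N B (fun z w => grad u z w ^+ 2).
    rewrite -[leRHS]addr0 -[0 in leRHS](mulr0 4) -E0 -!edge_sumZ -edge_sumD.
    apply: edge_sum_le => z w _ _ _; rewrite /grad /phi.
    have := W01 z; have := W01 w; set a := W z; set b := W w => /andP[b0 b1] /andP[a0 a1].
    set p := u z; set r := u w.
    have c1 : ((a + b) / 2) ^+ 2 <= 1 by rewrite -[1](expr1n _ 2) lerXn2r ?nnegrE; lra.
    have c2 := sqr_ge0 (4 * ((a + b) / 2) * (r - p) + (r + p) * (b - a)).
    have c3 := sqr_ge0 ((r - p) * (b - a)).
    have c4 : 0 <= (1 - ((a + b) / 2) ^+ 2) * (r - p) ^+ 2.
      by apply: mulr_ge0; [lra | exact: sqr_ge0].
    suff : 0 <= 8 * (r - p) ^+ 2 + 4 * ((b - a) * (b * r ^+ 2 - a * p ^+ 2)) -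
        (p ^+ 2 + r ^+ 2) * (b - a) ^+ 2 by lra.
    have -> : 8 * (r - p) ^+ 2 + 4 * ((b - a) * (b * r ^+ 2 - a * p ^+ 2)) -
        (p ^+ 2 + r ^+ 2) * (b - a) ^+ 2 =
      2^-1 * (4 * ((a + b) / 2) * (r - p) + (r + p) * (b - a)) ^+ 2
      + 2^-1 * ((r - p) * (b - a)) ^+ 2 + 8 * ((1 - ((a + b) / 2) ^+ 2) * (r - p) ^+ 2).
      by field.
    lra.
  have := @edge_term_le B (fun z w => (u z ^+ 2 + u w ^+ 2) * grad W z w ^+ 2) x y.
  move=> /(_ (fun z w => mulr_ge0 (addr_ge0 (sqr_ge0 _) (sqr_ge0 _)) (sqr_ge0 _))).
  rewrite !inE !eqxx !orbT => /(_ isT isT yx) h1.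
  by apply: le_trans h1 _; apply: le_trans le1 _; rewrite ler_pM2l.
have sq z : u_ n z ^+ 2 @[n --> F] --> (1 : R).
  rewrite -[X in _ --> X](mulr1 1) -(g1 z); under eq_fun do rewrite expr2.
  by apply: cvgM; apply: Hg.
have c1 : (u_ n x ^+ 2 + u_ n y ^+ 2) * grad W x y ^+ 2 @[n --> F] --> (1 + 1) * grad W x y ^+ 2.
  apply: cvgM; last exact: cvg_cst.
  by apply: cvgD; apply: sq.
have c2 : 8 * n.+1%:R^-1 @[n --> F] --> (8 * 0 : R).
  by apply: cvgM; [exact: cvg_cst | exact: cvg_inv_succ].
have h : (1 + 1) * grad W x y ^+ 2 <= 8 * 0.
  by apply: (ler_cvg_to c1 c2); apply: nearW.
have : grad W x y ^+ 2 = 0.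
  by apply/eqP; rewrite eq_le sqr_ge0 andbT; lra.
by move/eqP; rewrite sqrf_eq0 /grad subr_eq0 => /eqP.
Qed.

End ZeroCapacity.

(** * Zero capacity implies recurrence *)

Section Recurrence.
Context (R : realType) (V : choiceType) (K : set {fset V}) (hS : surface K).

Definition average (f : V -> R) (u : V) : R :=
  (deg K u)%:R^-1 * \sum_(w <- nbrs K u) f w.

Lemma deg_gt0 u : 0 < (deg K u)%:R :> R.
Proof.
have [w wu] := surf_nbrs_ex hS u; rewrite ltr0n cardfs_gt0.
by apply/fset0Pn; exists w.
Qed.

Lemma average_le f f' u : (forall w, f w <= f' w) -> average f u <= average f' u.
Proof.
move=> H; rewrite ler_pM2l ?invr_gt0 ?deg_gt0 //.
by apply: ler_sum => w _.
Qed.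

Lemma average_cst (c : R) u : average (fun _ => c) u = c.
Proof.
rewrite /average big_const_seq count_predT iter_addr addr0 -[c *+ _]mulr_natl.
by rewrite mulrA mulVf ?mul1r // lt0r_neq0 ?deg_gt0.
Qed.

Lemma cvg_average (f_ : nat -> V -> R) (f : V -> R) u :
  (forall w, f_ n w @[n --> \oo] --> f w) ->
  average (f_ n) u @[n --> \oo] --> average f u.
Proof.
move=> H; apply: cvgM; first exact: cvg_cst.
by apply: cvg_big => [|w _]; [exact: add_continuous | exact: H].
Qed.

Lemma laplacian_average f u : laplacian (nbrs K) f u = (deg K u)%:R * (average f u - f u).
Proof.
rewrite mulrBr /average mulrA mulfV ?lt0r_neq0 ?deg_gt0 // mul1r.
rewrite /laplacian /divergence /grad sumrB; congr (_ - _).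
by rewrite big_const_seq count_predT iter_addr addr0 mulr_natl.
Qed.

(** The probability, for the walk from [u], to be elsewhere than [v] at each of
    the times flagged in [s]. *)
Fixpoint avoid (v : V) (s : seq bool) (u : V) : R :=
  if s is b :: s' then (if b && (u == v) then 0 else average (avoid v s') u) else 1.

Lemma avoid_bd v s u : 0 <= avoid v s u <= 1.
Proof.
elim: s u => [|b s IH] u /=; first by rewrite ler01 lexx.
case: ifP => _; first by rewrite lexx ler01.
rewrite -{1}(average_cst 0 u) -(average_cst 1 u); apply/andP.
by split; apply: average_le => w; have /andP[] := IH w.
Qed.

Lemma avoid_true_nonincr v n u :
  avoid v (nseq n.+1 true) u <= avoid v (nseq n true) u.
Proof.
elim: n u => [|n IH] u; first by have /andP[] := avoid_bd v [:: true] u.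
rewrite [leLHS]/= [leRHS]/=; case: ifP => _; first exact: lexx.
by apply: average_le => w; apply: IH.
Qed.

(** The probability never to meet [v] is harmonic off [v], bounded, and zero at
    [v], hence zero everywhere if [v] has no capacity. *)
Lemma cvg_avoid v : capacity R (nbrs K) v <= 0 ->
  forall n u, avoid v (nseq n false ++ nseq m true) u @[m --> \oo] --> (0 : R).
Proof.
move=> cap0.
have lim u : cvgn (fun m => avoid v (nseq m true) u).
  apply: nonincreasing_is_cvgn.
    apply/nonincreasing_seqP => m; exact: avoid_true_nonincr.
  by exists 0 => _ [m _ <-]; have /andP[] := avoid_bd v (nseq m true) u.
pose W u := limn (fun m => avoid v (nseq m true) u).
have cW u : avoid v (nseq m true) u @[m --> \oo] --> W u by exact: lim.
have cWS u : avoid v (nseq m.+1 true) u @[m --> \oo] --> W u.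
  by have := cW u; rewrite -(cvg_shiftS (fun m => avoid v (nseq m true) u)).
have W0 : forall u, W u = 0.
  apply: (zero_capacity_liouville (nbrs_sym hS) (surf_connected hS) cap0).
  - move=> u; apply/andP; split.
      apply: (cvgr_to_ge (cW u)); apply: nearW => m.
      by have /andP[] := avoid_bd v (nseq m true) u.
    apply: (cvgr_to_le (cW u)); apply: nearW => m.
    by have /andP[] := avoid_bd v (nseq m true) u.
  - apply: (cvg_unique _ (cWS v)) => //.
    by apply: cvg_near_cst; apply: nearW => m; rewrite /= eqxx.
  move=> u uv; rewrite laplacian_average.
  suff -> : average W u = W u by rewrite subrr mulr0.
  apply: (cvg_unique _ (@cvg_average (fun m => avoid v (nseq m true)) W u cW)) => //.
  by have := cWS u; rewrite /= (negPf uv).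
elim=> [|n IH] u /=; first by have := cW u; rewrite W0.
rewrite -(average_cst 0 u).
exact: (@cvg_average (fun m => avoid v (nseq n false ++ nseq m true)) (fun=> 0) u IH).
Qed.

Section Walk.
Context (v0 : V) (d : measure_display) (Omega : measurableType d)
  (P : probability Omega R) (X : nat -> Omega -> V).
Context (hX : simple_random_walk K v0 P X) (v : V).

Let path n (x : nat -> V) := [set w | forall i, (i <= n)%N -> X i w = x i].
Let miss n (s : seq bool) :=
  [set w | forall j, nth false s j -> X (n + j)%N w <> v].

Lemma measurable_path n x : measurable (path n x).
Proof.
have [mX _ _] := hX.
have -> : path n x = \bigcap_(i in [set i | (i <= n)%N]) [set w | X i w = x i] by [].
by apply: bigcap_measurableType => i _; apply: mX.
Qed.

Lemma measurable_miss n s : measurable (miss n s).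
Proof.
have [mX _ _] := hX.
have -> : miss n s = \bigcap_(j in [set j | nth false s j]) ~` [set w | X (n + j)%N w = v] by [].
by apply: bigcap_measurableType => i _; apply/measurableC/mX.
Qed.

(** The Markov property, one step at a time: up to a null event the walk moves
    to a neighbour. *)
Lemma probability_miss s n x :
  (P (path n x `&` miss n s) <= P (path n x) * (avoid v s (x n))%:E)%E.
Proof.
have mp := measurable_path; have mm := measurable_miss.
elim: s n x => [|b s IH] n x.
  rewrite /= mule1; apply: le_measure; rewrite ?inE; [exact: (measurableI _ _ (mp _ _) (mm _ _))|exact: mp|].
  by move=> w [].
rewrite /=; case: ifP => [/andP[bt /eqP xv]|_].
  rewrite mule0; have -> : path n x `&` miss n (b :: s) = set0; last by rewrite measure0.
  apply/seteqP; split=> // w [Hp Hm]; have := Hm 0%N bt; rewrite addn0; apply.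
  by rewrite Hp.
pose ext y i := if i == n.+1 then y else x i.
have extn y : ext y n = x n by rewrite /ext ltn_eqF.
have extn1 y : ext y n.+1 = y by rewrite /ext eqxx.
have ext_path y : path n (ext y) = path n x.
  apply/seteqP; split=> w H i i_n; have := H i i_n; rewrite /ext;
    by rewrite ltn_eqF // ltnS.
pose E y := path n.+1 (ext y).
have Esub y : E y `<=` path n x.
  by rewrite -(ext_path y) => w H i i_n; apply: H; apply: leqW.
have EX y w : E y w -> X n.+1 w = y by move=> /(_ n.+1 (leqnn _)); rewrite extn1.
have PE y : y \in nbrs K (x n) -> P (E y) = (P (path n x) * ((deg K (x n))%:R^-1)%:E)%E.
  move=> yx; have [_ _ Hs] := hX.
  have := Hs n (ext y); rewrite -/(path n (ext y)) -/(path n.+1 (ext y)) ext_path extn extn1.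
  by rewrite /srw_step yx.
have PEs y : y \in nbrs K (x n) -> (P (E y `&` miss n (b :: s)) <=
    P (path n x) * ((deg K (x n))%:R^-1 * avoid v s y)%:E)%E.
  move=> yx; have := IH n.+1 (ext y); rewrite -/(E y) PE // extn1 -muleA -EFinM.
  apply: le_trans; apply: le_measure; rewrite ?inE;
    try exact: (measurableI _ _ (mp _ _) (mm _ _)).
  move=> w [Ew Hm]; split=> // j sj.
  by have := Hm j.+1 sj; rewrite addnS addSn.
have disj : trivIset [set` nbrs K (x n)] E.
  by apply/trivIsetP => y y' _ _ yy'; apply/seteqP; split=> // w [/EX E1 /EX E2]; rewrite -E1 -E2 eqxx in yy'.
set A := path n x `&` miss n (b :: s).
have mA : measurable A := measurableI _ _ (mp _ _) (mm _ _).
set U := \big[setU/set0]_(y <- nbrs K (x n)) E y.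
have mU : measurable U by apply: bigsetU_measurable => y _; apply: mp.
have US : U `<=` path n x.
  by rewrite /U -bigcup_seq => w [y _ /Esub].
have PU : P U = P (path n x).
  rewrite /U measure_fbigsetU //; last by move=> y _; apply: mp.
  transitivity (\sum_(y <- nbrs K (x n)) (P (path n x) * ((deg K (x n))%:R^-1)%:E))%E.
    by apply: eq_big_seq => y; apply: PE.
  have [r Pr] : exists r, P (path n x) = r%:E.
    by exists (fine (P (path n x))); rewrite fineK // fin_num_measure.
  rewrite Pr -EFinM sumEFin; congr EFin.
  rewrite big_const_seq count_predT iter_addr addr0 -[(r * _) *+ _]mulr_natr.
  by rewrite mulfVK // lt0r_neq0 ?deg_gt0.
have P0 : P (path n x `\` U) = 0%E.
  rewrite measureD //; last by rewrite ltey_eq fin_num_measure.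
  have -> : path n x `&` U = U by rewrite setIC setIidl.
  by rewrite [X in (_ - X)%E]PU subee // fin_num_measure.
have PAU : P (A `\` U) = 0%E.
  apply/eqP; rewrite eq_le measure_ge0 andbT -P0; apply: le_measure; rewrite ?inE.
  - exact: measurableD.
  - exact: (measurableD (mp _ _) mU).
  by move=> w [[]].
rewrite (@measureDI _ _ _ P A U) // [X in (X + _)%E]PAU add0e.
have -> : A `&` U = \big[setU/set0]_(y <- nbrs K (x n)) (E y `&` miss n (b :: s)).
  rewrite /U -!bigcup_seq; apply/seteqP; split=> w.
    by move=> [[_ Hm] [y yx Ey]]; exists y.
  by move=> [y yx [Ey Hm]]; split; [split=> //; exact: Esub Ey|exists y].
rewrite measure_fbigsetU; last first.
- apply/trivIsetP => y y' yx y'x yy'; apply/seteqP; split=> // w [[/EX E1 _] [/EX E2 _]].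
  by rewrite -E1 -E2 eqxx in yy'.
- by move=> y _; exact: (measurableI _ _ (mp _ _) (mm _ _)).
apply: (@le_trans _ _ (\sum_(y <- nbrs K (x n))
   (P (path n x) * ((deg K (x n))%:R^-1 * avoid v s y)%:E))%E).
  by rewrite big_seq [leRHS]big_seq; apply: lee_sum => y; apply: PEs.
rewrite -ge0_sume_distrr; last first.
  move=> y _; rewrite lee_fin mulr_ge0 // ?invr_ge0 ?ler0n //.
  by have /andP[] := avoid_bd v s y.
by rewrite sumEFin /average mulr_sumr.
Qed.

(** The probability of missing [v] from time [N] on is at most that of missing it
    at the times [N, ..., N + m - 1], for every [m]. *)
Lemma walk_visits : capacity R (nbrs K) v <= 0 ->
  P [set w | forall N, exists2 n, (N <= n)%N & X n w = v] = 1%E.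
Proof.
move=> cap0; have [mX X0 _] := hX.
pose G N := [set w | forall n, (N <= n)%N -> X n w <> v].
have mG N : measurable (G N).
  have -> : G N = \bigcap_(j in [set j | (N <= j)%N]) ~` [set w | X j w = v] by [].
  by apply: bigcap_measurableType => i _; apply/measurableC/mX.
pose S0 := path 0 (fun _ => v0).
have mS0 : measurable S0 by exact: measurable_path.
have PS0 : P S0 = 1%E.
  rewrite -X0; congr (P _); apply/seteqP; split=> w; first by apply.
  by move=> H [|i].
have PG N : P (G N) = 0%E.
  have PGS : P (G N) = P (S0 `&` G N).
    rewrite (@measureDI _ _ _ P (G N) S0) // setIC [X in (X + _)%E](_ : _ = 0%E) ?add0e //.
    apply/eqP; rewrite eq_le measure_ge0 andbT.
    apply: (@le_trans _ _ (P (~` S0))).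
      by apply: le_measure; rewrite ?inE; [exact: measurableD|exact: measurableC|move=> w []].
    by rewrite probability_setC // PS0 subee.
  have [r Pr] : exists r, P (G N) = r%:E.
    by exists (fine (P (G N))); rewrite fineK // fin_num_measure.
  rewrite Pr; congr EFin; apply/eqP; rewrite eq_le; apply/andP; split; last first.
    by rewrite -lee_fin -Pr measure_ge0.
  have le_avoid m : r <= avoid v (nseq N false ++ nseq m true) v0.
    rewrite -lee_fin -Pr PGS.
    have := probability_miss (nseq N false ++ nseq m true) 0 (fun _ => v0).
    rewrite -/S0 PS0 mul1e; apply: le_trans; apply: le_measure; rewrite ?inE.
    - exact: measurableI.
    - by apply: measurableI => //; apply: measurable_miss.
    move=> w [Sw Gw]; split=> // j; rewrite nth_cat size_nseq add0n.
    by case: ltnP => [jN|Nj _]; [rewrite nth_nseq jN|exact: Gw].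
  apply: (cvgr_to_ge (cvg_avoid cap0 N v0)); exact: nearW.
have mI : measurable [set w | forall N, exists2 n, (N <= n)%N & X n w = v].
  have -> : [set w | forall N, exists2 n, (N <= n)%N & X n w = v] = ~` \bigcup_N G N.
    apply/seteqP; split=> w.
      by move=> H [N _ GN]; have [n Nn Xn] := H N; apply: (GN n).
    move=> H N; apply: contrapT => nex; apply: H; exists N => // n Nn Xn.
    by apply: nex; exists n.
  by apply/measurableC/bigcupT_measurable.
have : P (~` [set w | forall N, exists2 n, (N <= n)%N & X n w = v]) = 0%E.
  apply: measure_negligible; first exact: measurableC.
  apply: (negligibleS (A := \bigcup_N G N)).
    move=> w H; apply: contrapT => nG; apply: H => N; apply: contrapT => nex.
    by apply: nG; exists N => // n Nn Xn; apply: nex; exists n.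
  apply: negligible_bigcup => N; exists (G N).
  by split; [exact: mG|exact: PG|].
rewrite probability_setC //.
have -> : P [set w | forall N, exists2 n, (N <= n)%N & X n w = v] =
   (fine (P [set w | forall N, exists2 n, (N <= n)%N & X n w = v]))%:E.
  by rewrite fineK // fin_num_measure.
by rewrite -EFinB => -[] /eqP; rewrite subr_eq0 => /eqP <-.
Qed.

End Walk.

Lemma transient_capacity : transient R K -> exists o, 0 < capacity R (nbrs K) o.
Proof.
move=> tr; apply: contrapT => nex; apply: tr => v0 d Omega P X hX v.
apply: (walk_visits hX); rewrite leNgt; apply/negP => h.
by apply: nex; exists v.
Qed.

End Recurrence.

(** * Rotations of the circle *)

Section Circle.
Context (R : realType).

Lemma lipschitz_of_derive (h dh : R -> R) (M t : R) :
  (forall x : R, is_derive x 1 h (dh x)) -> (forall x, `|x| <= `|t| -> `|dh x| <= M) ->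
  `|h t - h 0| <= `|t| * M.
Proof.
move=> hd bd.
have cont a b : {within `[a, b], continuous h}.
  have ch : continuous h.
    move=> x; apply: (@differentiable_continuous R R^o R^o).
    apply/(derivable1_diffP h x).1; exact: (@ex_derive _ _ _ _ _ _ _ (hd x)).
  exact: continuous_subspaceT.
have [t0|/ltW t0] := leP 0 t.
  have [x + ->] := MVT_segment t0 (fun x _ => hd x) (@cont _ _).
  rewrite in_itv /= => /andP[x0 xt]; rewrite subr0 normrM mulrC ler_wpM2l //.
  by apply: bd; rewrite !ger0_norm.
have [x + E] := MVT_segment t0 (fun x _ => hd x) (@cont _ _).
rewrite in_itv /= => /andP[xt x0]; rewrite distrC E sub0r normrM normrN mulrC ler_wpM2l //.
by apply: bd; rewrite !ler0_norm // lerN2.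
Qed.

(** Angles modulo a full turn, as points of the unit circle. *)
Definition circle := {z : R * R | z.1 ^+ 2 + z.2 ^+ 2 == 1}.

Definition rotate_pair (t : R) (z : R * R) : R * R :=
  (z.1 * cos t - z.2 * sin t, z.2 * cos t + z.1 * sin t).

Lemma rotate_pair_circle t (z : circle) :
  (rotate_pair t (val z)).1 ^+ 2 + (rotate_pair t (val z)).2 ^+ 2 == 1.
Proof.
case: z => -[c s] /= /eqP cs1; apply/eqP; have := cos2Dsin2 t.
set C := cos t; set S := sin t => CS1.
transitivity ((c ^+ 2 + s ^+ 2) * (C ^+ 2 + S ^+ 2)); first by ring.
by rewrite cs1 CS1 mulr1.
Qed.

Lemma conj_circle (z : circle) : (val z).1 ^+ 2 + (- (val z).2) ^+ 2 == 1.
Proof. by rewrite sqrrN (valP z). Qed.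

Definition rotate (t : R) (z : circle) : circle :=
  exist _ (rotate_pair t (val z)) (rotate_pair_circle t z).
Definition circle_conj (z : circle) : circle :=
  exist _ ((val z).1, - (val z).2) (conj_circle z).

Lemma rotate_action : rotation_action rotate circle_conj.
Proof.
split.
- move=> z; apply: val_inj; rewrite /= /rotate_pair cos0 sin0 !mulr1 !mulr0 subr0 addr0.
  by rewrite -surjective_pairing.
- move=> u t z; apply: val_inj; rewrite /= /rotate_pair /= cosD sinD.
  by congr pair; ring.
- by move=> z; apply: val_inj; rewrite /= opprK -surjective_pairing.
- move=> t z; apply: val_inj; rewrite /= /rotate_pair /= cosN sinN.
  by congr pair; ring.
Qed.

Lemma rotate_full_turn z : rotate (- (pi *+ 2)) z = z.
Proof.
apply: val_inj; rewrite /= /rotate_pair cosN sinN cos2pi sin2pi oppr0 !mulr1 !mulr0.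
by rewrite subr0 addr0 -surjective_pairing.
Qed.

Lemma is_derive_rotate (c s x : R) :
  is_derive x 1 (fun t => c * cos t - s * sin t) (- (s * cos x + c * sin x)) /\
  is_derive x 1 (fun t => s * cos t + c * sin t) (c * cos x - s * sin x).
Proof.
split.
  have -> : (fun t => c * cos t - s * sin t) = cst c * (@cos R) - cst s * (@sin R) by [].
  by apply: is_derive_eq; rewrite /GRing.scale /=; ring.
have -> : (fun t => s * cos t + c * sin t) = cst s * (@cos R) + cst c * (@sin R) by [].
by apply: is_derive_eq; rewrite /GRing.scale /=; ring.
Qed.

Lemma rotate_le1 (z : circle) : `|(val z).1| <= 1 /\ `|(val z).2| <= 1.
Proof.
case: z => -[c s] /= /eqP cs1.
have sq (x : R) : x ^+ 2 <= 1 -> `|x| <= 1.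
  move=> x1; have := real_normK (num_real x); have := normr_ge0 x.
  by move=> ? E; rewrite leNgt; apply/negP => ?; rewrite !expr2 in E x1; nra.
by split; apply: sq; have := sqr_ge0 c; have := sqr_ge0 s; lra.
Qed.

Lemma rotate_lipschitz t (z : circle) :
  `|(val (rotate t z)).1 - (val z).1| <= `|t| /\
  `|(val (rotate t z)).2 - (val z).2| <= `|t|.
Proof.
have b x := rotate_le1 (rotate x z).
split.
  have := @lipschitz_of_derive _ _ 1 t
    (fun x => (is_derive_rotate (val z).1 (val z).2 x).1) _.
  rewrite cos0 sin0 !mulr1 mulr0 subr0; apply=> x _.
  by rewrite normrN; have [_] := b x.
have := @lipschitz_of_derive _ _ 1 t
  (fun x => (is_derive_rotate (val z).1 (val z).2 x).2) _.
rewrite cos0 sin0 !mulr1 mulr0 addr0; apply=> x _.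
by have [] := b x.
Qed.

(** With [z = exp (i h)], the increments of [sin h] and of
    [h / 2 + sin (2 h) / 4] are the integrals of [cos] and of [cos ^ 2], so the
    latter is close to the former times any value close to [cos h]. *)
Lemma rotate_estimate t (z z' : circle) (f : R) : z' = rotate t z ->
  `|((val z').2 - (val z).2) * f -
     (t / 2 + ((val z').2 * (val z').1 - (val z).2 * (val z).1) / 2)|
    <= `|t| * (`|f - (val z).1| + `|t|).
Proof.
move=> ->{z'}; set z' := rotate t z; set c := (val z).1; set s := (val z).2.
pose C x := c * cos x - s * sin x; pose S x := s * cos x + c * sin x.
have CS x : C x ^+ 2 + S x ^+ 2 = 1 by have /eqP := rotate_pair_circle x z.
pose h x := S x * f - (x / 2 + S x * C x / 2).
have hd (x : R) : is_derive x 1 h (C x * (f - C x)).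
  have [dC dS] := is_derive_rotate c s x.
  rewrite -/(C x) -/(S x) in dC dS.
  have -> : h = S * cst f - (id * cst 2^-1 + S * C * cst 2^-1) by [].
  have dC' : is_derive x 1 C (- S x) := dC.
  have dS' : is_derive x 1 S (C x) := dS.
  apply: is_derive_eq; rewrite /GRing.scale /=.
  by have := CS x; rewrite /cst /=; lra.
have C0 : C 0 = c by rewrite /C cos0 sin0; lra.
have S0 : S 0 = s by rewrite /S cos0 sin0; lra.
have -> : ((val z').2 - s) * f - (t / 2 + ((val z').2 * (val z').1 - s * c) / 2) =
    h t - h 0.
  by rewrite /h C0 S0 /= /rotate_pair -/(C t) -/(S t) -/c -/s; lra.
apply: (lipschitz_of_derive hd) => x xt; rewrite normrM.
have [C1 _] : `|C x| <= 1 /\ `|S x| <= 1 := rotate_le1 (rotate x z).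
rewrite -[leRHS]mul1r; apply: ler_pM => //.
have -> : f - C x = (f - c) - (C x - c) by lra.
apply: le_trans (ler_normB _ _) _; rewrite lerD2l.
by apply: le_trans xt; have [] := rotate_lipschitz x z.
Qed.

End Circle.

(** * Boundaries of 2-chains *)

Section Boundary.
Context (R : realType) (V : choiceType) (K : set {fset V}) (hS : surface K).

Definition alternating_fun (F : V -> V -> V -> R) : Prop :=
  forall a b c, triangle K a b c -> F b a c = - F a b c /\ F a c b = - F a b c.

(** The boundary of the 2-chain [F], given by its values on oriented
    triangles. *)
Definition boundary (F : V -> V -> V -> R) (a b : V) : R :=
  \sum_(c <- nbrs K a | `[< triangle K a b c >]) F a b c.

Lemma boundary_two F a b c d : c != d -> triangle K a b c -> triangle K a b d ->
  boundary F a b = F a b c + F a b d.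
Proof.
move=> cd Tc Td; have [x [y [xy Tx Ty H]]] := surf_apexes hS (surf_edge hS Tc).
rewrite /boundary -big_filter (perm_big [:: c; d]) /=; last first.
  apply: uniq_perm; first by rewrite filter_uniq.
    by rewrite /= inE cd.
  move=> e; rewrite mem_filter !inE; apply/andP/orP.
    move=> [/asboolP Te _].
    have := H e Te; move: cd; case: (H c Tc) => ->; case: (H d Td) => ->;
      by rewrite ?eqxx // => _ [] ->; rewrite eqxx; auto.
  move=> [/eqP ->|/eqP ->]; split; try exact/asboolP.
    exact: surf_edge (triangle_swapr Tc).
  exact: surf_edge (triangle_swapr Td).
by rewrite !big_cons big_nil addr0.
Qed.

Lemma boundary_anti F a b : alternating_fun F -> boundary F a b = - boundary F b a.
Proof.
move=> aF; rewrite /boundary -sumrN -big_filter -[RHS]big_filter.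
rewrite (perm_big [seq c <- nbrs K b | `[< triangle K b a c >]]) /=; last first.
  apply: uniq_perm; rewrite ?filter_uniq // => e; rewrite !mem_filter.
  apply/andP/andP => -[/asboolP T _]; have T' := triangle_swap T; split.
  - exact/asboolP.
  - exact: surf_edge (triangle_swapr T').
  - exact/asboolP.
  - exact: surf_edge (triangle_swapr T').
rewrite !big_filter; apply: eq_bigr => c /asboolP T.
by have [->] := aF _ _ _ T.
Qed.

(** The boundary of a boundary is zero: the sum over the ordered pairs [(b, c)]
    changes sign when [b] and [c] are exchanged. *)
Lemma divergence_boundary F a : alternating_fun F ->
  divergence (nbrs K) (boundary F) a = 0.
Proof.
move=> aF; set D := divergence _ _ _.
suff : D = - D by move=> E; lra.
rewrite {1}/D /divergence /boundary (exchange_big_dep xpredT) //= -sumrN.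
apply: eq_bigr => c _; rewrite -sumrN.
apply: eq_big => [b|b /asboolP T].
  by apply/asboolP/asboolP; apply: triangle_swapr.
by have [_ ->] := aF _ _ _ (triangle_swapr T).
Qed.

End Boundary.

Lemma near_sup (R : realType) (T : Type) (F : T -> R) (t0 : T) (C : R) :
  (forall t, F t <= C) -> forall e, 0 < e -> exists t1, forall t, F t <= F t1 + e.
Proof.
move=> FC e e0; have hs : has_sup (range F).
  by split; [exists (F t0); exists t0|exists C => _ [t _ <-]].
have [_ [t1 _ <-] h] := sup_adherent e0 hs.
exists t1 => t; have : F t <= sup (range F) by apply: ub_le_sup; [case: hs|exists t].
lra.
Qed.

Lemma uniq_sum_le (R : realType) (T : eqType) (s A : seq T) (F : T -> R) :
  uniq s -> uniq A -> {subset s <= A} -> (forall x, 0 <= F x) ->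
  \sum_(x <- s) F x <= \sum_(x <- A) F x.
Proof.
move=> us uA sA F0; rewrite (perm_big [seq x <- A | x \in s]) /=; last first.
  apply: uniq_perm; rewrite ?filter_uniq // => x; rewrite mem_filter.
  by case: (boolP (x \in s)) => // /sA ->.
rewrite big_filter [leLHS]big_mkcond /=; apply: ler_sum => x _.
by case: ifP.
Qed.

Lemma sum_sqr_le (R : realType) (T : Type) (s : seq T) (F : T -> R) :
  (\sum_(x <- s) F x) ^+ 2 <= (size s)%:R * \sum_(x <- s) F x ^+ 2.
Proof.
elim: s => [|x s IH]; first by rewrite !big_nil expr0n mul0r.
rewrite !big_cons /= -[in (size s).+1%:R]addn1 natrD.
set a := F x; set A := \sum_(y <- s) F y in IH *; set B := \sum_(y <- s) F y ^+ 2 in IH *.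
set n := (size s)%:R in IH *.
suff : 2 * (a * A) <= n * a ^+ 2 + B by move: IH; rewrite !expr2; lra.
rewrite /A /B /n {IH A B n}.
elim: s => [|y s IH]; first by rewrite !big_nil mulr0 mulr0 mul0r addr0.
rewrite !big_cons /= -[in (size s).+1%:R]addn1 natrD.
by have := sqr_ge0 (a - F y); move: IH; rewrite !expr2; lra.
Qed.

(** * The cosine of a multivalued angle and its flows *)

(** [z a b c = exp (i h)], where the angle [h] of the oriented triangle [abc]
    changes sign with the orientation and jumps by [th] across edges. Its cosine
    does not depend on the orientation, and its sine is a 2-chain. *)
Section Angle.
Context (R : realType) (V : choiceType) (K : set {fset V}) (hS : surface K).
Context (th : V -> V -> R) (z : V -> V -> V -> circle R).
Hypothesis th_anti : forall u v, th u v = - th v u.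
Hypothesis hz : primitive_mod K (@rotate R) (@circle_conj R) th z.

Definition cosine a b c : R := (val (z a b c)).1.
Definition sine a b c : R := (val (z a b c)).2.
Definition angle_variation v : R := \sum_(w <- nbrs K v) `|th v w|.

Lemma angle_variation_ge0 v : 0 <= angle_variation v.
Proof. exact: sumr_ge0. Qed.

Lemma th_le_angle_variation v w : w \in nbrs K v -> `|th v w| <= angle_variation v.
Proof.
move=> wv; rewrite /angle_variation (big_rem w) //= lerDl.
exact: sumr_ge0.
Qed.

Lemma cosine_sym a b c : triangle K a b c ->
  cosine b a c = cosine a b c /\ cosine a c b = cosine a b c.
Proof. by move=> T; have [h _] := hz; have [E1 E2] := h _ _ _ T; rewrite /cosine E1 E2. Qed.

Lemma sine_alternating : alternating_fun K sine.
Proof.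
by move=> a b c T; have [h _] := hz; have [E1 E2] := h _ _ _ T; rewrite /sine E1 E2.
Qed.

Lemma sine_cosine_alternating :
  alternating_fun K (fun a b c => sine a b c * cosine a b c).
Proof.
move=> a b c T; have [-> ->] := sine_alternating T; have [-> ->] := cosine_sym T.
by rewrite !mulNr.
Qed.

Lemma flip a b c d : triangle K a b c -> triangle K a b d -> c != d ->
  z a d b = rotate (th a b) (z a b c).
Proof. by have [_] := hz; apply. Qed.

Lemma cosine_flip a b c d : triangle K a b c -> triangle K a b d ->
  `|cosine a b c - cosine a b d| <= `|th a b|.
Proof.
move=> Tc Td; have [->|cd] := eqVneq c d; first by rewrite subrr normr0.
have [h _] := rotate_lipschitz (th a b) (z a b c).
move: h; rewrite -(flip Tc Td cd) -/(cosine a d b) -/(cosine a b c) distrC.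
by have [_ ->] := cosine_sym Td.
Qed.

(** Two consecutive triangles around [v] are separated by one edge. *)
Lemma link_path_oscillation v : forall (p : seq V) x c c', triangle K v x c ->
  path (fun y y' => `[< triangle K v y y' >]) x p ->
  triangle K v (last x p) c' ->
  `|cosine v x c - cosine v (last x p) c'| <= \sum_(w <- x :: p) `|th v w|.
Proof.
elim=> [|y p IH] x c c' Tc /=; first by move=> _ Tc'; rewrite big_seq1; apply: cosine_flip.
move=> /andP[/asboolP Ty py] Tc'; rewrite big_cons.
have -> : cosine v x c - cosine v (last y p) c' =
  (cosine v x c - cosine v x y) + (cosine v y x - cosine v (last y p) c').
  by have [_ ->] := cosine_sym Ty; lra.
apply: le_trans (ler_normD _ _) _; apply: lerD; first exact: cosine_flip.
by apply: IH => //; apply: triangle_swapr.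
Qed.

(** Move from one triangle to the other along a simple path of the link, which
    crosses each edge at [v] at most once. *)
Lemma link_oscillation v b c b' c' : triangle K v b c -> triangle K v b' c' ->
  `|cosine v b c - cosine v b' c'| <= angle_variation v.
Proof.
move=> T T'.
pose e (y y' : nbrs K v) := `[< triangle K v (val y) (val y') >].
have bv := surf_edge hS T; have bv' := surf_edge hS T'.
have conn : connect e (FSetSub bv) (FSetSub bv').
  pose A w := forall h : w \in nbrs K v, connect e (FSetSub bv) (FSetSub h).
  suff : A b' by apply.
  apply: (@surf_link _ _ hS v A b) => //.
    by move=> h; rewrite (bool_irrelevance h bv) connect0.
  move=> x y Ax Txy h; apply: connect_trans (Ax (surf_edge hS Txy)) _.
  by apply: connect1; apply/asboolP.
have /connectP [p0 ep0 lastp0] := conn.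
move: lastp0; case/shortenP: ep0 => p ep up _ lastp.
have vlast : last b (map val p) = b'.
  by rewrite -[b]/(val (FSetSub bv)) last_map -lastp.
have pathp : path (fun y y' => `[< triangle K v y y' >]) b (map val p).
  by rewrite -[b]/(val (FSetSub bv)) path_map.
have := @link_path_oscillation v (map val p) b c c' T pathp.
rewrite vlast => /(_ T') h; apply: le_trans h _.
rewrite -[b :: _]/(map val (FSetSub bv :: p)).
apply: uniq_sum_le => //; first by rewrite map_inj_uniq //; apply: val_inj.
by move=> w /mapP [y _ ->]; apply: valP.
Qed.

Lemma boundary_flip (G : circle R -> R) a b c d :
  triangle K a b c -> triangle K a b d -> c != d ->
  alternating_fun K (fun a b c => G (z a b c)) ->
  boundary K (fun a b c => G (z a b c)) a b = G (z a b c) - G (rotate (th a b) (z a b c)).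
Proof.
move=> Tc Td cd aG; rewrite (boundary_two hS _ cd Tc Td) -(flip Tc Td cd).
by have [_ ->] := aG _ _ _ (triangle_swapr Td).
Qed.

(** Across an edge, the increment of [sin h]: the integral of [cos] over the
    interval of angles that the edge covers. *)
Definition sine_flow a b : R := - boundary K sine a b.

(** Across an edge, the increment of [h / 2 + sin (2 h) / 4]: the integral of
    [cos ^ 2] over the interval of angles that the edge covers. *)
Definition weighted_flow a b : R :=
  th a b / 2 - boundary K (fun a b c => sine a b c * cosine a b c) a b / 2.

Lemma sine_flow_anti a b : sine_flow a b = - sine_flow b a.
Proof. by rewrite /sine_flow (boundary_anti hS _ _ sine_alternating). Qed.

Lemma weighted_flow_anti a b : weighted_flow a b = - weighted_flow b a.
Proof.
rewrite /weighted_flow (boundary_anti hS _ _ sine_cosine_alternating) th_anti.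
lra.
Qed.

Lemma divergence_sine_flow a : divergence (nbrs K) sine_flow a = 0.
Proof.
by rewrite /divergence sumrN [X in - X](divergence_boundary a sine_alternating) oppr0.
Qed.

(** The mean of [cos ^ 2] over a turn is [1 / 2]. *)
Lemma divergence_weighted_flow a :
  divergence (nbrs K) weighted_flow a = divergence (nbrs K) th a / 2.
Proof.
rewrite /divergence sumrB -!mulr_suml.
have := divergence_boundary a sine_cosine_alternating; rewrite /divergence => ->.
by rewrite mul0r subr0.
Qed.

Lemma sine_flow_le a b : b \in nbrs K a -> `|sine_flow a b| <= `|th a b|.
Proof.
move=> ba; have [c [d [cd Tc Td _]]] := surf_apexes hS ba.
rewrite /sine_flow (boundary_flip (G := fun w => (val w).2) Tc Td cd sine_alternating).
by rewrite opprB; have [_] := rotate_lipschitz (th a b) (z a b c).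
Qed.

Lemma flow_estimate a b f : b \in nbrs K a ->
  (forall c, triangle K a b c -> `|f - cosine a b c| <= angle_variation a) ->
  `|sine_flow a b * f - weighted_flow a b| <= 2 * angle_variation a * `|th a b|.
Proof.
move=> ba Hf; have [c [d [cd Tc Td _]]] := surf_apexes hS ba.
have := rotate_estimate f (erefl (rotate (th a b) (z a b c))).
rewrite /sine_flow (boundary_flip (G := fun w => (val w).2) Tc Td cd sine_alternating).
rewrite /weighted_flow (boundary_flip (G := fun w => (val w).2 * (val w).1) Tc Td cd
  sine_cosine_alternating) opprB.
set X := (X in `|X| <= _ -> _); set Y := (Y in _ -> `|Y| <= _) => h.
have -> : Y = X by rewrite /X /Y; lra.
apply: le_trans h _; rewrite mulrC ler_wpM2r //.
have := Hf c Tc; have := th_le_angle_variation ba; rewrite /cosine; lra.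
Qed.

End Angle.

(** * Harmonic functions of finite energy *)

Section EnergyBounds.
Context (R : realType) (V : choiceType) (K : set {fset V}) (hS : surface K).
Let N := nbrs K.

Lemma star_sum_le (B : {fset V}) (t : V -> V -> R) : (forall x y, 0 <= t x y) ->
  \sum_(x <- B) \sum_(y <- N x) t x y <= edge_sum N (hull N B) t.
Proof.
move=> t0.
apply: (@le_trans _ _ (\sum_(x <- B) \sum_(y <- hull N B | y \in N x) t x y)).
  rewrite big_seq [leRHS]big_seq; apply: ler_sum => x xB.
  rewrite -(@big_fset_sub _ _ (N x) (hull N B) xpredT) //.
  by apply/fsubsetP => y; apply: hull_nbr.
apply: uniq_sum_le; rewrite ?fset_uniq //.
  exact/fsubsetP/sub_hull.
by move=> x; apply: sumr_ge0.
Qed.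

Lemma square_bound_dirichlet (h : V -> R) C : square_bound N (grad h) C ->
  dirichlet_finite K h.
Proof.
move=> hC; rewrite /dirichlet_finite /dirichlet_energy.
set S := (\esum_(p in _) _)%E.
suff SC : (S <= C%:E)%E.
  apply: (@le_lt_trans _ _ ((2^-1)%:E * C%:E)%E); last by rewrite -EFinM ltry.
  by apply: lee_wpmul2l => //; rewrite lee_fin invr_ge0.
apply: ge_ereal_sup => _ [A [finA subA] <-].
rewrite fsbig_finite //= sumEFin lee_fin.
pose T := fset_set A; pose B := ([fset p.1 | p in T] `|` [fset p.2 | p in T])%fset.
apply: le_trans (hC B).
have -> : edge_sum N B (fun x y => grad h x y ^+ 2) =
    \sum_(p <- [seq (x, y) | x <- B, y <- B])
      (if p.2 \in N p.1 then grad h p.1 p.2 ^+ 2 else 0).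
  rewrite big_allpairs; apply: eq_bigr => x _.
  by rewrite [LHS]big_mkcond.
rewrite big_seq (eq_bigr (fun p => if p.2 \in N p.1 then grad h p.1 p.2 ^+ 2 else 0)).
  rewrite -big_seq; apply: uniq_sum_le.
  - exact: fset_uniq.
  - by apply: allpairs_uniq; rewrite ?fset_uniq // => -[x1 y1] [x2 y2].
  - move=> p pT; apply/allpairsP; exists p; rewrite -surjective_pairing; split=> //.
      by rewrite inE; apply/orP; left; apply/imfsetP; exists p.
    by rewrite inE; apply/orP; right; apply/imfsetP; exists p.
  by move=> p; case: ifP => _; rewrite ?sqr_ge0.
move=> p pT; have : p \in A by rewrite -(in_fset_set finA).
rewrite inE => /subA [ne Kp].
have -> : p.2 \in N p.1.
  by apply/(surf_nbrs hS); split=> //; apply/eqP => E; apply: ne.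
by rewrite /grad -sqrrN opprB.
Qed.

Lemma laplacian_harmonic (h : V -> R) : (forall x, laplacian N h x = 0) ->
  harmonic_function K h.
Proof.
move=> h0 v; have := h0 v; rewrite (laplacian_average hS) => /eqP.
by rewrite mulf_eq0 gt_eqF ?(deg_gt0 R hS) //= subr_eq0 => /eqP.
Qed.

End EnergyBounds.

Theorem theorem1p2 (R : realType) (V : choiceType) (K : set {fset V})
    (hK : triangulation_of_open_disc R K)
    (hdeg : bounded_degree K)
    (htrans : transient R K) :
  exists f : V -> R,
    (exists u v, f u <> f v) /\ dirichlet_finite K f /\ harmonic_function K f.
Proof.
have hS := triangulation_surface hK.
have hsc := triangulation_simply_connected hK.
have [ o cap] := transient_capacity hS htrans.
pose N := nbrs K; have Nsym : forall u v, (u \in N v) = (v \in N u) := nbrs_sym hS.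
have [g [gE gpos glap glapo cut]] := green_function Nsym (surf_connected hS) cap.
set m := capacity R (nbrs K) o in cap gE cut.
(* With this factor the flux of [g] out of [o] is one full turn. *)
pose mu := pi *+ 2 / - laplacian N g o.
have mu0 : 0 < mu.
  by rewrite divr_gt0 ?oppr_gt0 // mulr2n; have := pi_gt0 R; lra.
pose i x y := mu * grad g x y.
have i_anti x y : i x y = - i y x by rewrite /i -mulrN grad_anti.
have i_div x : divergence N i x = mu * laplacian N g x.
  by rewrite /divergence -mulr_sumr.
have i_div_o : divergence N i o = - (pi *+ 2).
  rewrite i_div /mu invrN mulrN mulNr mulfVK //.
  by apply/eqP => E; rewrite /N E ltxx in glapo.
have cyc v w : rotate (\sum_(u <- nbrs K v) i v u) w = w.
  have [->|vo] := eqVneq v o.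
    by rewrite -[X in rotate X]/(divergence N i o) i_div_o rotate_full_turn.
  rewrite -[X in rotate X]/(divergence N i v) i_div glap // mulr0.
  by have := rot_zero (rotate_action R) w.
have one_circle : circle R.
  by exists (1, 0); rewrite /= expr1n expr0n addr0.
have [z hz] := primitive_mod_ex hS hsc (rotate_action R) i_anti cyc o one_circle.
have iE := square_boundZ mu gE : square_bound N i (mu ^+ 2 * m).
pose a := angle_variation K i.
have a0 x : 0 <= a x by apply: angle_variation_ge0.
have [D hD] := hdeg.
have a_bd (B : {fset V}) : \sum_(x <- B) a x ^+ 2 <= D%:R * (mu ^+ 2 * m).
  apply: (@le_trans _ _ (D%:R * \sum_(x <- B) \sum_(y <- N x) i x y ^+ 2)).
    rewrite mulr_sumr; apply: ler_sum => x _; apply: le_trans (sum_sqr_le _ _) _.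
    under eq_bigr do rewrite real_normK ?num_real //.
    apply: ler_wpM2r; first by apply: sumr_ge0 => y _; apply: sqr_ge0.
    by rewrite ler_nat; apply: hD.
  rewrite ler_wpM2l ?ler0n //; apply: le_trans (iE (hull N B)).
  by apply: star_sum_le => *; apply: sqr_ge0.
have flag_ex v : exists bc : V * V, triangle K v bc.1 bc.2.
  have [b bv] := surf_nbrs_ex hS v; have [c [_ [_ T _ _]]] := surf_apexes hS bv.
  by exists (b, c).
have [fl hfl] := choice flag_ex.
(* The candidate: the cosine of the angle, read at some triangle of each vertex. *)
pose f v := cosine z v (fl v).1 (fl v).2.
have f_osc v b c : triangle K v b c -> `|f v - cosine z v b c| <= a v.
  exact: (link_oscillation hS hz (hfl v)).
have f_bd v : -1 <= f v <= 1.
  by rewrite -ler_norml; have [] := rotate_le1 (z v (fl v).1 (fl v).2).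
have f_edge x y : y \in N x -> `|grad f x y| <= a x + a y.
  move=> yx; have [c [_ [_ T _ _]]] := surf_apexes hS yx.
  have h1 := f_osc _ _ _ T; have h2 := f_osc _ _ _ (triangle_swap T).
  have [E _] := cosine_sym hz T; rewrite E in h2.
  have -> : grad f x y = (f y - cosine z x y c) - (f x - cosine z x y c).
    by rewrite /grad; ring.
  by apply: le_trans (ler_normB _ _) _; rewrite addrC lerD.
have fE : square_bound N (grad f) (4 * (D%:R * (D%:R * (mu ^+ 2 * m)))).
  move=> B.
  apply: (@le_trans _ _ (edge_sum N B (fun x y => 2 * a x ^+ 2 + 2 * a y ^+ 2))).
    apply: edge_sum_le => x y _ _ /f_edge h.
    have : grad f x y ^+ 2 <= (a x + a y) ^+ 2.
      by rewrite -(real_normK (num_real (grad f x y))) lerXn2r ?nnegrE // addr_ge0.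
    by have := sqr_ge0 (a x - a y); rewrite !expr2; lra.
  rewrite edge_sumD !edge_sumZ [X in _ + 2 * X](edge_sum_swap Nsym).
  suff : edge_sum N B (fun x _ => a x ^+ 2) <= D%:R * (D%:R * (mu ^+ 2 * m)) by lra.
  apply: (@le_trans _ _ (D%:R * \sum_(x <- B) a x ^+ 2)); last first.
    by rewrite ler_wpM2l ?ler0n.
  rewrite mulr_sumr; apply: ler_sum => x _; rewrite -big_filter.
  apply: (@le_trans _ _ (\sum_(y <- N x) a x ^+ 2)).
    apply: uniq_sum_le; rewrite ?filter_uniq ?fset_uniq //.
    - by move=> y; rewrite mem_filter => /andP[].
    - by move=> _; apply: sqr_ge0.
  rewrite big_const_seq count_predT iter_addr addr0 -[a x ^+ 2 *+ _]mulr_natl.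
  by rewrite ler_wpM2r ?sqr_ge0 // ler_nat; apply: hD.
have [F [u_ [h [[PF Foo Hu Hh] [hE _ _ hlap _]]]]] :=
  minimizer_limit Nsym fE (fun _ => False) f_bd.
set mf := min_energy N f (fun _ => False) in Hu hE.
have [nonconst|const] := pselect (exists u v, h u <> h v).
  exists h; split=> //; split; first exact: square_bound_dirichlet hE.
  by apply: laplacian_harmonic => // x; apply: hlap.
exfalso.
have mf0 : 0 <= mf := min_energy_ge0 fE (fun _ => False).
pose om := sine_flow K z; pose ka := weighted_flow K i z.
have om_le x y : y \in N x -> `|om x y| <= `|i x y| by apply: (sine_flow_le hS hz).
have omE : square_bound N om (mu ^+ 2 * m) by apply: (square_bound_mono iE).
have om_anti x y : om x y = - om y x by apply: (sine_flow_anti hS hz).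
have ka_anti x y : ka x y = - ka y x by apply: (weighted_flow_anti hS i_anti hz).
suff main tau : 0 < tau -> pi *+ 2 <= tau * (2 * mu * (m + 1) + 1 + (1 + (mf + 1)) / 2).
  have m0 : 0 < m := cap.
  have K0 : 0 <= 2 * mu * (m + 1) + 1 + (1 + (mf + 1)) / 2.
    by have h1 : 0 <= mu * (m + 1) by [rewrite mulr_ge0 ?addr_ge0 ?ltW]; lra.
  have [tau tau0 htau] := small_choice K0 (pi_gt0 R).
  by have := main tau tau0; have := pi_gt0 R; rewrite mulr2n; lra.
move=> tau0.
(* Off a finite set the angle oscillates by at most [tau] around a vertex. *)
have [A0 hA0] : exists A0 : {fset V}, forall x, x \notin A0 -> a x <= tau.
  have [A0 hA0] := near_sup fset0 a_bd (exprn_gt0 2 tau0).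
  exists A0 => x xA0; have := hA0 (x |` A0)%fset.
  rewrite big_fsetU1 //= addrC lerD2l => h2.
  by rewrite -(ler_pXn2r (n := 2)) ?nnegrE ?a0 ?(ltW tau0).
(* The energy of [om] off [B0] is at most [tau ^+ 2]. *)
have [B0 hB0] := near_sup fset0 omE (exprn_gt0 2 tau0).
(* [h] is constant, so some [u_ n] is almost constant on [B0]. *)
have [n hn] : exists n, edge_sum N B0 (fun x y => `|om x y| * `|grad (u_ n) x y|) <= tau.
  have : edge_sum N B0 (fun x y => `|om x y| * `|grad (u_ n) x y|) @[n --> F] -->
      edge_sum N B0 (fun x y => `|om x y| * `|grad h x y|).
    apply: (@cvg_edge_sum _ _ N F PF (fun n x y => `|om x y| * `|grad (u_ n) x y|)) => x y.
    apply: cvgM; first exact: cvg_cst.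
    by apply: cvg_norm; apply: cvgB; apply: Hh.
  have -> : edge_sum N B0 (fun x y => `|om x y| * `|grad h x y|) = 0.
    rewrite (edge_sum_eq (t' := fun _ _ => 0 * 0)) ?edge_sumZ ?mul0r // => x y _ _ _.
    rewrite /grad (_ : h y - h x = 0) ?normr0 ?mulr0 //.
    apply/eqP; rewrite subr_eq0; apply/eqP; apply: contrapT => hyx; apply: const.
    by exists y, x.
  move=> /cvgr_lt/(_ _ tau0) /filter_ex [n hn]; exists n; exact: ltW.
have [[[An uAn] _] un_E _] := Hu n; set u := u_ n in hn uAn un_E.
have inv1 : n.+1%:R^-1 <= 1 :> R by rewrite invf_le1 // ler1n.
have u_E : square_bound N (grad u) (mf + 1).
  by apply: square_bound_le un_E _; rewrite lerD2l.
(* Where [grad chi] is not zero, [u = f] and the angle oscillates little. *)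
pose A1 := (hull N A0 `|` hull N An `|` [fset o])%fset.
have [chi [[Ac chiA] chi_bd chi1 hchi]] := cut A1.
have chi_o : chi o = 1 by apply: chi1; rewrite !inE eqxx orbT.
have oAc : o \in Ac.
  by apply/negPn/negP => /chiA; rewrite chi_o => /eqP; rewrite oner_eq0.
pose B := (hull N Ac `|` B0)%fset.
have HB : (hull N Ac `<=` B)%fset by apply: fsubsetUl.
(* The flux of the weighted flow out of [o], which is half a turn counted with
   both orientations of the edges. *)
have flux : edge_sum N B (fun x y => ka x y * grad chi x y) = pi *+ 2.
  rewrite (edge_sum_by_parts Nsym HB chiA ka_anti) (bigD1_seq o) //= ?fset_uniq //.
  have kd x : divergence N ka x = divergence N i x / 2 by apply: (divergence_weighted_flow hz).
  rewrite big1 => [|x xo]; first by rewrite kd i_div_o chi_o mulr2n; field.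
  by rewrite kd i_div glap // mulr0 mul0r mulr0.
have uchiA : supported Ac (fun x => u x * chi x).
  by move=> x /chiA ->; rewrite mulr0.
have zero : edge_sum N B (fun x y => om x y * grad (fun x => u x * chi x) x y) = 0.
  rewrite (edge_sum_by_parts Nsym HB uchiA om_anti) big1 ?mulr0 // => x _.
  have -> : divergence N om x = 0 by apply: (divergence_sine_flow hz).
  by rewrite mulr0.
(* The product rule for [grad (u * chi)]; the last two terms are the errors. *)
have pointwise x y : y \in N x -> ka x y * grad chi x y <=
    om x y * grad (fun x => u x * chi x) x y +
    ((2 * tau * mu) * (`|grad g x y| * `|grad chi x y|) + `|om x y| * `|grad u x y|).
  move=> yx.
  have -> : ka x y * grad chi x y = om x y * grad (fun x => u x * chi x) x y
     - (om x y * u x - ka x y) * grad chi x y - om x y * (chi y * grad u x y).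
    by rewrite /grad; ring.
  rewrite -addrA lerD2l; apply: lerD; last first.
    apply: le_trans (ler_norm _) _; rewrite normrN !normrM ler_wpM2l //.
    have /andP[chi0 chi_le1] := chi_bd y.
    by rewrite ger0_norm // -[leRHS]mul1r ler_wpM2r.
  have [eqchi|nechi] := eqVneq (chi x) (chi y).
    by rewrite /grad eqchi subrr normr0 !mulr0 oppr0.
  have hull_chi A : (hull N A `<=` A1)%fset -> x \notin A.
    move=> AA1; apply: contraNN nechi => xA; rewrite !chi1 //; apply: (fsubsetP AA1).
      exact: hull_nbr yx.
    exact: (fsubsetP (sub_hull N A)).
  have xA0 : x \notin A0 by apply: hull_chi; rewrite /A1 -fsetUA fsubsetUl.
  have xAn : x \notin An.
    by apply: hull_chi; rewrite /A1 [(hull N A0 `|` _)%fset]fsetUC -fsetUA fsubsetUl.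
  have -> : u x = f x by apply/eqP; rewrite -subr_eq0 uAn.
  rewrite -mulNr; apply: le_trans (ler_norm _) _; rewrite normrM normrN [leRHS]mulrA.
  rewrite ler_wpM2r //; have := flow_estimate hS hz yx (fun c => @f_osc x y c).
  move=> h1; apply: le_trans h1 _.
  have -> : `|i x y| = mu * `|grad g x y| by rewrite /i normrM gtr0_norm.
  rewrite -[leRHS]mulrA; apply: ler_wpM2r; first by rewrite mulr_ge0 // ltW.
  by rewrite ler_pM2l //; apply: hA0.
have le1 : edge_sum N B (fun x y => ka x y * grad chi x y) <=
   (2 * tau * mu) * (m + 1) + edge_sum N B (fun x y => `|om x y| * `|grad u x y|).
  apply: (@le_trans _ _ (edge_sum N B (fun x y =>
      om x y * grad (fun x => u x * chi x) x y +
      ((2 * tau * mu) * (`|grad g x y| * `|grad chi x y|) + `|om x y| * `|grad u x y|)))).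
    by apply: edge_sum_le => x y _ _; apply: pointwise.
  rewrite !edge_sumD zero add0r edge_sumZ lerD2r.
  apply: ler_wpM2l (hchi B).
  by apply: mulr_ge0; [apply: mulr_ge0 => //|]; exact: ltW.
rewrite flux in le1; apply: le_trans le1 _.
pose out x y := if (x \in B0) && (y \in B0) then 0 else om x y.
have B0B : (B0 `<=` B)%fset by apply: fsubsetUr.
have split_sum : edge_sum N B (fun x y => `|om x y| * `|grad u x y|) =
    edge_sum N B0 (fun x y => `|om x y| * `|grad u x y|) +
    edge_sum N B (fun x y => `|out x y| * `|grad u x y|).
  rewrite (edge_sum_widen _ _ B0B) -edge_sumD; apply: edge_sum_eq => x y _ _ _.
  by rewrite /out; case: ifP => _; rewrite ?normr0 ?mul0r ?addr0 ?add0r.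
have out_sq : edge_sum N B (fun x y => out x y ^+ 2) <= tau ^+ 2.
  have := hB0 B; rewrite (edge_sum_widen _ (fun x y => om x y ^+ 2) B0B).
  rewrite -lerBlDl -edge_sumB; apply: le_trans; apply: edge_sum_le => x y _ _ _.
  by rewrite /out; case: ifP => _; rewrite ?subrr ?subr0 ?expr0n.
have tau_inv : 0 < tau^-1 by rewrite invr_gt0.
have amgm := edge_sum_amgm N B out (grad u) tau_inv.
rewrite invrK in amgm.
have h1 : tau^-1 * edge_sum N B (fun x y => out x y ^+ 2) <= tau.
  by rewrite -[leRHS](mulKf (lt0r_neq0 tau0)) ler_pM2l // -expr2.
have h2 : tau * edge_sum N B (fun x y => grad u x y ^+ 2) <= tau * (mf + 1).
  by rewrite ler_pM2l.
rewrite split_sum; lra.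
Qed.
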